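(* Consider, for a partitioned variable $x=(y,z)$ with $y\in\mathbb R^{n_y}$, $z\in\mathbb R^{n_z}$, the problem $$\max\ f_0(x)\quad\text{s.t.}\quad y\le f_y(x),\quad x\in\mathcal X, \qquad (Q)$$ where $\mathcal X=\{(y,z): y\in\mathcal X_y,\ z\in\mathcal X_z\}$, $\mathcal X_y=\{y:a_y\le y\le b_y\}$, $\mathcal X_z=\{z:a_z\le z\le b_z\}$, with data as in the context. Problem $(Q)$ is equivalent to the problem obtained by adding the constraint $z\le f_z(x)$, where $f_z(x):=b_z$ is constant. Suppose that (a) the subproblem $(f_{0|z},f_{y|z})$ fulfills the General Qualifying Condition for all $z\in\mathcal X_z$, and that it holds for all $x\in\mathcal X$ that either (b.i) $\nabla_zf_0(x)\ge0$, and $\nabla_zf_y(x)\ge0$ with non-zero rows; or (b.ii) $\nabla_zf_0(x)\ge0$ with non-zero rows, and $\nabla_zf_y(x)\ge0$; or (b.iii) $$\frac{\|\nabla_zf_y(x)\|_\infty}{1-\|\nabla_yf_y(x)\|_\infty}<\frac{\delta_z(x)}{\Delta_y(x)},$$ where $\delta_z(x)=\min_{i,j}[\nabla_zf_0(x)]_{ij}$ and $\Delta_y(x)=\max_{i,j}[\nabla_yf_0(x)]_{ij}$. Then problem $(Q)$ is Fast-Lipschitz.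
   Context: Data: $n=n_y+n_z$; $f_0:\mathbb R^n\to\mathbb R^m$ ($m\ge1$) and $f_y:\mathbb R^n\to\mathbb R^{n_y}$ are differentiable; $a_y,b_y\in\mathbb R^{n_y}$, $a_z,b_z\in\mathbb R^{n_z}$. Put $f(x)=(f_y(x),f_z(x))$ with $f_z(x)=b_z$. Notation: all inequalities between vectors or matrices are element-wise. Gradients are transposed Jacobians: $[\nabla h(x)]_{ij}=\partial h_j(x)/\partial x_i$; $\nabla_y h$ and $\nabla_zh$ denote the blocks of rows corresponding to derivatives in $y$ and in $z$. ''With non-zero rows'' means that every row is non-zero. $\|A\|_\infty=\max_i\sum_j|A_{ij}|$. Pareto optimality: maximization is with respect to the non-negative orthant of $\mathbb R^m$; a feasible $\hat x$ is Pareto optimal if there is no other feasible $x$ with $f_0(x)\ge f_0(\hat x)$. Standing assumption: attention is restricted to a bounding box, here $\mathcal D=\mathcal X$, which is assumed to contain all candidates for optimality and to be mapped into itself by $f$, i.e. $f:\mathcal D\to\mathcal D$. Fast-Lipschitz: $(Q)$ is Fast-Lipschitz if it admits a unique Pareto optimal solution $x^\star$, defined as the unique solution of $x^\star=f(x^\star)$, i.e. $y^\star=f_y(y^\star,z^\star)$, $z^\star=b_z$. Subproblem: for fixed $z\in\mathcal X_z$, $f_{0|z}(y)=f_0(y,z)$ and $f_{y|z}(y)=f_y(y,z)$; the subproblem $(f_{0|z},f_{y|z})$ is $\max f_{0|z}(y)$ s.t. $y\le f_{y|z}(y)$, $y\in\mathcal X_y$. It fulfills the General Qualifying Condition if for every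 $y\in\mathcal X_y$ the following holds with $h_0=f_{0|z}$, $h=f_{y|z}$ and $q(y)=\min_j\frac{\min_i[\nabla h_0(y)]_{ij}}{\max_i[\nabla h_0(y)]_{ij}}$: (1) $\nabla h_0(y)\ge0$ with non-zero rows; (2) $\|\nabla h(y)\|<1$ for some (sub-multiplicative) matrix norm, the same for all $y\in\mathcal X_y$; and there exists $k\in\{1,2,\dots\}\cup\{\infty\}$ such that (3) when $k<\infty$, the matrix power $\nabla h(y)^k\ge0$; (4) when $k>1$, $\left\|\sum_{l=1}^{k-1}\nabla h(y)^l\right\|_\infty<q(y)$.
   Formalization: Condition (b.iii) additionally requires ‖∇_y f_y(x)‖_∞ < 1; without it the denominator may be negative and the claim fails, e.g. f_y = (10−5z, 2y_1+10−5z), f_0 = y_1+y_2+z/1000 on [0,10]×[0,30]×[0,1]. *)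

(* Defs.v *)
(* MathComp-Analysis, over an arbitrary R : realType.  Points of R^n are row
   vectors 'rV[R]_n, and a partitioned point is x = row_mx y z, so that
   y = lsubmx x and z = rsubmx x. *)
From mathcomp Require Export all_boot all_order all_algebra.
From mathcomp Require Export all_classical all_reals all_analysis.
Export Order.TTheory GRing.Theory Num.Theory numFieldNormedType.Exports.

Set Implicit Arguments.
Unset Strict Implicit.
Unset Printing Implicit Defensive.

Local Open Scope classical_set_scope.
Local Open Scope ring_scope.

Section ElementwiseOrder.
Variable R : realType.

Definition lemx m n (A B : 'M[R]_(m, n)) : Prop := forall i j, A i j <= B i j.

Definition nonzero_rows m n (A : 'M[R]_(m, n)) : Prop :=
  forall i, row i A != 0.

Definition box n (a b : 'rV[R]_n) : set 'rV[R]_n :=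
  [set v | lemx a v /\ lemx v b].

Definition prod_box ny nz (Xy : set 'rV[R]_ny) (Xz : set 'rV[R]_nz) :
    set 'rV[R]_(ny + nz) :=
  [set x | Xy (lsubmx x) /\ Xz (rsubmx x)].

(* The default element is the value at ord0, so that these are the true
   minimum and maximum of a nonempty finite family, whatever its signs. *)
Definition ord_min n (F : 'I_n.+1 -> R) : R :=
  \big[Num.min/F ord0]_(i < n.+1) F i.

Definition ord_max n (F : 'I_n.+1 -> R) : R :=
  \big[Num.max/F ord0]_(i < n.+1) F i.

End ElementwiseOrder.

Section MatrixNorms.
Variable R : realType.

Definition norm_infty m n (A : 'M[R]_(m, n)) : R :=
  \big[Num.max/0]_(i < m) \sum_(j < n) `|A i j|.

Definition submul_matrix_norm n (N : 'M[R]_n -> R) : Prop :=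
  [/\ forall A, N A = 0 -> A = 0,
      forall c A, N (c *: A) = `|c| * N A,
      forall A B, N (A + B) <= N A + N B &
      forall A B, N (A *m B) <= N A * N B].

(* Sum of A ^+ l over 1 <= l < k; None stands for k = oo.  The limit exists
   as soon as some submultiplicative norm of A is less than 1. *)
Definition power_sum n (A : 'M[R]_n) (k : option nat) : 'M[R]_n :=
  if k is Some p then \sum_(1 <= l < p) A ^+ l
  else limn (fun p => \sum_(1 <= l < p) A ^+ l).

End MatrixNorms.

Section Gradients.
Variable R : realType.

(* The library's Jacobian acts on row vectors from the right: its entry (i, j)
   is the derivative of h_j with respect to x_i, i.e. it is the transpose of
   the usual Jacobian matrix. *)
Definition grad n m (h : 'rV[R]_n -> 'rV[R]_m) (x : 'rV[R]_n) : 'M[R]_(n, m) :=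
  'J h x.

Definition grad_y ny nz m (h : 'rV[R]_(ny + nz) -> 'rV[R]_m)
    (x : 'rV[R]_(ny + nz)) : 'M[R]_(ny, m) := usubmx (grad h x).

Definition grad_z ny nz m (h : 'rV[R]_(ny + nz) -> 'rV[R]_m)
    (x : 'rV[R]_(ny + nz)) : 'M[R]_(nz, m) := dsubmx (grad h x).

End Gradients.

Section Optimization.
Variable R : realType.

(* Maximization of f0 over F, with respect to the nonnegative orthant. *)
Definition pareto_optimal n m (f0 : 'rV[R]_n -> 'rV[R]_m) (F : set 'rV[R]_n)
    (xh : 'rV[R]_n) : Prop :=
  F xh /\ ~ (exists x, [/\ F x, x <> xh & lemx (f0 xh) (f0 x)]).

(* f is a self-map of D, and its fixed points are sought in D. *)
Definition fast_lipschitz n m (f0 : 'rV[R]_n -> 'rV[R]_m)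
    (F D : set 'rV[R]_n) (f : 'rV[R]_n -> 'rV[R]_n) : Prop :=
  exists xs : 'rV[R]_n,
    [set x | pareto_optimal f0 F x] = [set xs] /\
    [set x | D x /\ x = f x] = [set xs].

Definition q_ratio n m (G : 'M[R]_(n.+1, m.+1)) : R :=
  ord_min (fun j => ord_min (fun i => G i j) / ord_max (fun i => G i j)).

Definition general_qualifying_condition n m
    (h0 : 'rV[R]_n.+1 -> 'rV[R]_m.+1) (h : 'rV[R]_n.+1 -> 'rV[R]_n.+1)
    (X : set 'rV[R]_n.+1) : Prop :=
  exists N : 'M[R]_n.+1 -> R, submul_matrix_norm N /\
  forall y, X y ->
    [/\ lemx 0 (grad h0 y) /\ nonzero_rows (grad h0 y),
        N (grad h y) < 1 &
        exists k : option nat,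
          [/\ k <> Some 0%N,
              forall p, k = Some p -> lemx 0 (grad h y ^+ p) &
              k <> Some 1%N ->
                norm_infty (power_sum (grad h y) k) < q_ratio (grad h0 y)]].

End Optimization.

Section PartitionedProblem.
Variables (R : realType) (ny nz m : nat).
Variables (f0 : 'rV[R]_(ny.+1 + nz.+1) -> 'rV[R]_m.+1)
          (fy : 'rV[R]_(ny.+1 + nz.+1) -> 'rV[R]_ny.+1).

Definition feasible_Q (X : set 'rV[R]_(ny.+1 + nz.+1)) :
    set 'rV[R]_(ny.+1 + nz.+1) :=
  [set x | lemx (lsubmx x) (fy x) /\ X x].

Definition feasible_full
    (f : 'rV[R]_(ny.+1 + nz.+1) -> 'rV[R]_(ny.+1 + nz.+1))
    (X : set 'rV[R]_(ny.+1 + nz.+1)) : set 'rV[R]_(ny.+1 + nz.+1) :=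
  [set x | lemx x (f x) /\ X x].

Definition with_const_z (bz : 'rV[R]_nz.+1) (x : 'rV[R]_(ny.+1 + nz.+1)) :
    'rV[R]_(ny.+1 + nz.+1) := row_mx (fy x) bz.

Definition delta_z (x : 'rV[R]_(ny.+1 + nz.+1)) : R :=
  ord_min (fun i => ord_min (fun j => grad_z f0 x i j)).

Definition Delta_y (x : 'rV[R]_(ny.+1 + nz.+1)) : R :=
  ord_max (fun i => ord_max (fun j => grad_y f0 x i j)).

Definition cond_i (x : 'rV[R]_(ny.+1 + nz.+1)) : Prop :=
  lemx 0 (grad_z f0 x) /\ (lemx 0 (grad_z fy x) /\ nonzero_rows (grad_z fy x)).

Definition cond_ii (x : 'rV[R]_(ny.+1 + nz.+1)) : Prop :=
  (lemx 0 (grad_z f0 x) /\ nonzero_rows (grad_z f0 x)) /\ lemx 0 (grad_z fy x).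

(* The left-hand side is the sum of the geometric series of ratio
   norm_infty (grad_y fy x), which must therefore be less than 1: with a zero
   or negative denominator the inequality would not bound grad_z fy x, and the
   problem could then fail to be Fast-Lipschitz. *)
Definition cond_iii (x : 'rV[R]_(ny.+1 + nz.+1)) : Prop :=
  norm_infty (grad_y fy x) < 1 /\
  norm_infty (grad_z fy x) / (1 - norm_infty (grad_y fy x))
    < delta_z x / Delta_y x.

End PartitionedProblem.

(* Main.v *)
Require Import Defs.
From mathcomp Require Import ring lra.

(** Scalarize: for a column [lam] of positive weights, consider the objective
    [u |-> f0 u *m lam] on the feasible set, which is compact.  The plan is to
    show that every maximizer of every such objective is a fixed point of [f],
    and that [f] has a single fixed point [xs] in the box.  Then [xs] is the
    unique maximizer for all positive weights.  Letting one weight dominate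
    gives [f0 x <= f0 xs] entrywise for every feasible [x], and the weights
    [lam = 1] show that [f0 xs <= f0 x] fails for every other feasible [x], so
    that [xs] is the only Pareto optimal point ([scalarized_optimum],
    [le_of_positive_weights]).

    Fixed points.  For fixed [z] the map [h y = fy (y, z)] sends a box to
    itself and its gradients have norm less than 1.  The gradients need not be
    continuous, so there may be no uniform contraction constant.  A minimizer
    of the norm of [h y - y] over the box is nevertheless a fixed point, since
    a small step towards [h y] would decrease this norm, and two fixed points
    are excluded by a similar minimization along the segment that joins them
    ([contraction_fixed_point], [contraction_fixed_point_unique]).

    Slack constraints.  Let [A] be the gradient of [h] at a feasible [y] and
    [c] that of the scalarized objective.  For [S] the sum of the [A ^+ l] with
    [1 <= l < k] one has [(1 + S) (1 - A) = 1 - Q], where [Q = A ^+ k], or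
    [Q = 0] when [k] is infinite.  The qualifying condition makes [Q]
    nonnegative, the row sums of [|S|] less than 1 and [(1 + S) c] positive
    ([qualifying_certificate]).  A direction [d = f (1 + S)] then has gain
    [f (1 + S) c], positive when [f] is nonnegative and nonzero, and satisfies
    [d - d A = f - f Q], so that a tight constraint [i] survives to first order
    when [f] vanishes at [i].  Hence a slack constraint, where [f] may be
    positive, gives an improvement, provided that [d] does not leave the box.
    At the lower bounds this is achieved by choosing [f] as a fixed point of a
    contraction in the sum norm: row vectors are contracted by [S] because the
    row sums of [|S|] are less than 1.  At the upper bounds it comes for free,
    from the signs that the first-order conditions for [h] to map the box to
    itself impose on [A] ([upper_block_zero], [improving_direction],
    [slack_constraint_improvement]).

    The parameter [z].  It remains to exclude a maximizer [(y, z)] with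
    [y = fy (y, z)] and some [z_i] below its upper bound.  When [z_i] grows
    by [t], the fixed point [y] moves by [t B_i (1 - A)^-1 + o(t)], where [B_i] is
    row [i] of the gradient in [z], and fixed points are feasible.  With [C_i]
    the derivative of the objective in [z_i], the gain per unit of [t] is
    [C_i + B_i (1 - A)^-1 c], and each of the three alternatives on the
    gradients in [z] makes it positive ([marginal_gain_gt0],
    [parameter_improvement]). *)

Set Implicit Arguments.
Unset Strict Implicit.
Unset Printing Implicit Defensive.

Local Open Scope classical_set_scope.
Local Open Scope ring_scope.


(** * Entrywise bounds and first-order expansions *)

Lemma entry_le_norm (R : realType) m n (A : 'M[R]_(m, n)) i j : `|A i j| <= `|A|.
Proof.
by rewrite [leRHS]/Num.norm /= mx_normrE; apply/bigmax_geP; right => /=; exists (i, j).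
Qed.

Lemma norm_le_entries (R : realType) m n (A : 'M[R]_(m, n)) e :
  0 <= e -> (forall i j, `|A i j| <= e) -> `|A| <= e.
Proof.
by move=> e0 le_Ae; rewrite /Num.norm /= mx_normrE;
  apply/bigmax_leP; split=> // -[i j] _ /=.
Qed.

Definition entry_sum (R : realType) m n (A : 'M[R]_(m, n)) : R :=
  \sum_i \sum_j `|A i j|.

Lemma entry_sum_ge0 (R : realType) m n (A : 'M[R]_(m, n)) : 0 <= entry_sum A.
Proof. by apply: sumr_ge0 => i _; apply: sumr_ge0. Qed.

Lemma norm_mulmx_le (R : realType) m n p (A : 'M[R]_(m, n)) (B : 'M[R]_(n, p)) :
  `|A *m B| <= `|A| * entry_sum B.
Proof.
apply: norm_le_entries => [|i j]; first by rewrite mulr_ge0 ?entry_sum_ge0.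
rewrite mxE (le_trans (ler_norm_sum _ _ _)) // mulr_sumr ler_sum // => l _.
rewrite normrM ler_pM ?entry_le_norm //.
by rewrite (bigD1 j) //= lerDl sumr_ge0.
Qed.

(** Fréchet differentiability with a given gradient, in the form in which it is
    used throughout: the rates of change along lines and along curves both come
    from this single estimate. *)
Definition expands (R : realType) m n (F : 'rV[R]_m -> 'rV[R]_n) (x : 'rV[R]_m)
    (G : 'M[R]_(m, n)) : Prop :=
  forall e, 0 < e ->
    \forall v \near (0 : 'rV[R]_m), `|F (x + v) - F x - v *m G| <= e * `|v|.

Lemma differentiable_expands (R : realType) m n (F : 'rV[R]_m -> 'rV[R]_n) x :
  differentiable F x -> expands F x (grad F x).
Proof.
move=> dF e e0.
have /eqaddoP /(_ e e0) := diff_locally dF; apply: filterS => v /=.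
rewrite !fctE /= -deriveE // deriveEjacobian //.
congr (Num.norm _ <= _).
by rewrite [v + x]addrC [LHS]addrC opprD [LHS]addrC addrA.
Qed.

Lemma row_mxl_continuous (R : realType) m n (z : 'rV[R]_n) :
  continuous (fun y : 'rV[R]_m => row_mx y z).
Proof.
move=> y; apply/(@cvgrPdist_le _ _ _ (nbhs y)) => e e0.
apply/nbhs_ballP; exists e => //= v.
rewrite -ball_normE /= => yv.
rewrite opp_row_mx add_row_mx subrr; apply: norm_le_entries (ltW e0) _ => i j.
rewrite mxE; case: (fintype.split j) => l; last by rewrite mxE normr0 ltW.
by rewrite (le_trans (entry_le_norm _ _ _)) // ltW.
Qed.

Lemma differentiable_row_mxl (R : realType) m n p
    (F : 'rV[R]_(m + n) -> 'rV[R]_p) y z :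
  differentiable F (row_mx y z) -> differentiable (fun y => F (row_mx y z)) y.
Proof.
move=> dF.
have row_mxD v : row_mx v z = mulmxr (row_mx 1%:M 0) v + row_mx 0 z.
  by rewrite /= mul_mx_row mulmx1 mulmx0 add_row_mx addr0 add0r.
have -> : (fun y => F (row_mx y z)) =
    F \o (mulmxr (row_mx 1%:M 0) + cst (row_mx 0 z)).
  by apply/funext => v; rewrite /= row_mxD.
apply: differentiable_comp; last by rewrite !fctE /= -row_mxD.
apply: differentiableD => //; apply: linear_differentiable.
have ext (f : 'rV[R]_m -> 'rV[R]_(m + n)) : f =1 row_mx^~ 0 -> continuous f.
  by move=> /funext ->; exact: row_mxl_continuous.
by apply: ext => v; rewrite /= mul_mx_row mulmx1 mulmx0.
Qed.

Lemma grad_row_mxl (R : realType) m n p (F : 'rV[R]_(m + n) -> 'rV[R]_p) y z :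
  differentiable F (row_mx y z) ->
  grad (fun y => F (row_mx y z)) y = grad_y F (row_mx y z).
Proof.
move=> dF; apply/row_matrixP => i; rewrite !rowE.
rewrite -deriveEjacobian; last exact: (differentiable_row_mxl dF).
transitivity ('D_(row_mx (delta_mx 0 i) 0) F (row_mx y z)).
  rewrite /derive; set u := fun h => _; set w := fun h => _.
  suff -> : u = w by [].
  apply/funext => t; rewrite /u /w /=.
  by rewrite scale_row_mx add_row_mx scaler0 add0r.
rewrite deriveEjacobian // /grad_y /grad -{1}(vsubmxK ('J F _)) mul_row_col.
by rewrite mul0mx addr0.
Qed.


(** * Minima on compact sets and a fixed point in the sum norm *)

Lemma lipschitz_continuous (R : realType) (V : normedModType R) (F : V -> R) k :
  0 < k -> (forall u v, `|F u - F v| <= k * `|u - v|) -> continuous F.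
Proof.
move=> k0 lipF u; apply/(@cvgrPdist_le _ _ _ (nbhs u)) => e e0.
apply/nbhs_ballP; exists (e / k) => /=; first exact: divr_gt0.
move=> v; rewrite -ball_normE /= => uv.
by rewrite (le_trans (lipF _ _)) // mulrC -ler_pdivlMr // ltW.
Qed.

Lemma closed_sublevel (R : realType) (V : normedModType R) (F : V -> R) r :
  continuous F -> closed [set v | F v <= r].
Proof.
move=> cF; apply: (@closed_comp _ _ F [set x | x <= r]); last exact: closed_le.
by move=> v _; exact: cF.
Qed.

Lemma compact_argmin (R : realType) (V : normedModType R) (F : V -> R) (K : set V) :
  K !=set0 -> compact K -> continuous F ->
  exists2 v, K v & forall u, K u -> F v <= F u.
Proof.
move=> K0 cK cF; have [v /set_mem Kv minF] :=
  compact_EVT_min K0 cK (continuous_subspaceT cF).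
by exists v => // u Ku; apply: minF; exact: mem_set.
Qed.

(** The sum norm is the one for which bounds on the row sums of a matrix control
    its action on row vectors. *)
Definition l1 (R : realType) n (v : 'rV[R]_n) : R := \sum_i `|v 0 i|.

Lemma l1_ge0 (R : realType) n (v : 'rV[R]_n) : 0 <= l1 v.
Proof. exact: sumr_ge0. Qed.

Lemma le_l1D (R : realType) n (u v : 'rV[R]_n) : l1 (u + v) <= l1 u + l1 v.
Proof. by rewrite -big_split ler_sum // => i _; rewrite mxE ler_normD. Qed.

Lemma l1N (R : realType) n (v : 'rV[R]_n) : l1 (- v) = l1 v.
Proof. by apply: eq_bigr => i _; rewrite mxE normrN. Qed.

Lemma l1_eq0 (R : realType) n (v : 'rV[R]_n) : l1 v <= 0 -> v = 0.
Proof.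
move=> v0; apply/rowP => i; rewrite mxE; apply/normr0_eq0/le_anti.
rewrite normr_ge0 andbT (le_trans _ v0) // /l1 (bigD1 i) //= lerDl.
exact: sumr_ge0.
Qed.

Lemma l1_le_norm (R : realType) n (v : 'rV[R]_n) : l1 v <= n%:R * `|v|.
Proof.
rewrite mulr_natl (_ : `|v| *+ n = \sum_(i < n) `|v|).
  by apply: ler_sum => i _; exact: entry_le_norm.
by rewrite sumr_const card_ord.
Qed.

Lemma norm_le_l1 (R : realType) n (v : 'rV[R]_n) : `|v| <= l1 v.
Proof.
apply: norm_le_entries (l1_ge0 v) _ => i j; rewrite ord1.
by rewrite /l1 (bigD1 j) //= lerDl sumr_ge0.
Qed.

Lemma l1_mulmx_le (R : realType) m n (v : 'rV[R]_m) (S : 'M[R]_(m, n)) s :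
  (forall i, \sum_j `|S i j| <= s) -> l1 (v *m S) <= s * l1 v.
Proof.
move=> Ss; rewrite mulr_sumr.
apply: (@le_trans _ _ (\sum_j \sum_i `|v 0 i| * `|S i j|)).
  apply: ler_sum => j _; rewrite mxE (le_trans (ler_norm_sum _ _ _)) //.
  by apply: ler_sum => i _; rewrite normrM.
rewrite exchange_big /=; apply: ler_sum => i _.
by rewrite -mulr_sumr mulrC ler_wpM2r.
Qed.

(** The map sending [f] to the row of the [phi i ((f *m S) 0 i)] is a contraction
    for the sum norm.  Its fixed points solve linear complementarity problems:
    for instance [phi i x = max (0, b i - x)] yields [f >= 0] and [f + f S >= b]
    with equality wherever [f] is positive.  The proof minimizes the residual
    over a ball that the map sends to itself. *)
Lemma nonexpansive_fixed_point (R : realType) n (S : 'M[R]_n) s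
    (phi : 'I_n -> R -> R) :
  0 <= s < 1 -> (forall i, \sum_j `|S i j| <= s) ->
  (forall i x y, `|phi i x - phi i y| <= `|x - y|) ->
  exists f : 'rV[R]_n, forall i, f 0 i = phi i ((f *m S) 0 i).
Proof.
move=> /andP[s0 s1] Ss lip_phi.
pose T (f : 'rV[R]_n) : 'rV[R]_n := \row_i phi i ((f *m S) 0 i).
have Tcontr f g : l1 (T f - T g) <= s * l1 (f - g).
  apply: le_trans (l1_mulmx_le (f - g) Ss); rewrite mulmxBl ler_sum // => i _.
  by rewrite !mxE (le_trans (lip_phi _ _ _)).
pose K := [set f : 'rV[R]_n | l1 f <= l1 (T 0) / (1 - s)].
have s1' : 0 < 1 - s by lra.
have l1cont : continuous (@l1 R n).
  apply: (@lipschitz_continuous _ _ _ n.+1%:R) => // u v.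
  apply: (@le_trans _ _ (l1 (u - v))).
    rewrite ler_norml; have := le_l1D (u - v) v; have := le_l1D (v - u) u.
    rewrite !subrK -(l1N (u - v)) opprB => h1 h2; apply/andP; split; lra.
  by rewrite (le_trans (l1_le_norm _)) // ler_wpM2r // ler_nat.
have cK : compact K.
  apply: bounded_closed_compact; last exact: closed_sublevel.
  exists (l1 (T 0) / (1 - s)); split; first exact: num_real.
  move=> M /ltW lt_M f Kf.
  exact: le_trans (norm_le_l1 _) (le_trans Kf lt_M).
have K0 : K !=set0.
  exists 0; rewrite /K /= (_ : l1 0 = 0) ?divr_ge0 ?l1_ge0 ?ltW //.
  by rewrite /l1 big1 // => i _; rewrite mxE normr0.
have KT f : K f -> K (T f).
  rewrite /K /= !ler_pdivlMr // => Kf.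
  have := le_l1D (T f - T 0) (T 0); rewrite subrK => h.
  have := Tcontr f 0; rewrite subr0 => h'.
  have := ler_wpM2l s0 Kf; nra.
have rescont : continuous (fun f => l1 (T f - f)).
  apply: (@lipschitz_continuous _ _ _ (2 * n.+1%:R)) => // u v.
  apply: (@le_trans _ _ (2 * l1 (u - v))).
    have h1 := Tcontr u v; have h2 := Tcontr v u.
    have h3 : l1 (v - u) = l1 (u - v) by rewrite -l1N opprB.
    have h4 := le_l1D (T u - T v) (T v - v + (v - u)).
    have h5 := le_l1D (T v - T u) (T u - u + (u - v)).
    have h6 := le_l1D (T v - v) (v - u).
    have h7 := le_l1D (T u - u) (u - v).
    have e1 : T u - T v + (T v - v + (v - u)) = T u - u.
      by rewrite !addrA !subrK.
    have e2 : T v - T u + (T u - u + (u - v)) = T v - v.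
      by rewrite !addrA !subrK.
    rewrite e1 in h4; rewrite e2 in h5; rewrite h3 in h2 h6.
    have h8 : s * l1 (u - v) <= l1 (u - v) by rewrite ler_piMl ?l1_ge0 ?ltW.
    by rewrite ler_norml; apply/andP; split; lra.
  rewrite -mulrA ler_wpM2l // (le_trans (l1_le_norm _)) // ler_wpM2r // ler_nat //.
have [f Kf minf] := compact_argmin K0 cK rescont.
have : l1 (T f - f) <= 0.
  have := minf _ (KT _ Kf); have := Tcontr (T f) f.
  have := l1_ge0 (T f - f); nra.
by move=> /l1_eq0/subr0_eq Tf; exists f => i; rewrite -{1}Tf mxE.
Qed.


(** * Nonnegative matrices whose powers vanish *)

Definition vanishing_powers (R : realType) n (Q : 'M[R]_n.+1) : Prop :=
  forall e, 0 < e -> exists p, forall i j, `|(Q ^+ p) i j| <= e.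

Lemma vanishing_powers_row (R : realType) n (Q : 'M[R]_n.+1) (v : 'rV_n.+1) e :
  vanishing_powers Q -> 0 < e -> exists m, forall j, `|(v *m Q ^+ m) 0 j| <= e.
Proof.
move=> Qv e0; have l0 : 0 < l1 v + 1 by rewrite ltr_wpDl // l1_ge0.
have [m Qm] := Qv _ (divr_gt0 e0 l0); exists m => j.
rewrite mxE (le_trans (ler_norm_sum _ _ _)) //.
apply: (@le_trans _ _ (l1 v * (e / (l1 v + 1)))).
  by rewrite mulr_suml ler_sum // => l _; rewrite normrM ler_wpM2l.
by rewrite mulrCA ger_pMr // ler_pdivrMr // mul1r; lra.
Qed.

(** Iterating [p <= p Q] gives [p <= p Q^m], which tends to 0. *)
Lemma vanishing_powers_subfix_row (R : realType) n (Q : 'M[R]_n.+1) (p : 'rV_n.+1) :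
  lemx 0 Q -> vanishing_powers Q -> lemx p (p *m Q) -> lemx p 0.
Proof.
move=> Q0 Qv pQ.
have pQm m : lemx p (p *m Q ^+ m).
  elim: m => [|m IH] i j; first by rewrite expr0 mulmx1.
  rewrite exprSr mulmxA (le_trans (pQ i j)) // !mxE ler_sum // => l _.
  by rewrite ler_wpM2r // (le_trans _ (Q0 l j)) // mxE.
move=> i j; rewrite [leRHS]mxE ord1 {i}; apply/ler_addgt0Pr => e e0.
have [m Qm] := vanishing_powers_row p Qv e0.
by rewrite add0r (le_trans (pQm m 0 j)) // (le_trans (ler_norm _)).
Qed.

Lemma trmx_exp (R : realType) n (Q : 'M[R]_n.+1) p : (Q ^+ p)^T = Q^T ^+ p.
Proof.
elim: p => [|p IH]; first by rewrite !expr0 trmx1.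
by rewrite exprS exprSr -!mulmxE trmx_mul IH.
Qed.

Lemma vanishing_powers_subfix_col (R : realType) n (Q : 'M[R]_n.+1) (w : 'cV_n.+1) :
  lemx 0 Q -> vanishing_powers Q -> lemx (Q *m w) w -> lemx 0 w.
Proof.
move=> Q0 Qv Qw i j.
have /(_ j i) : lemx (- w)^T 0.
  apply: (@vanishing_powers_subfix_row _ _ Q^T).
  - by move=> k l; rewrite !mxE; have := Q0 l k; rewrite mxE.
  - move=> e /Qv[p Qp]; exists p => k l.
    by rewrite -trmx_exp mxE.
  - by move=> k l; rewrite -trmx_mul mulmxN !mxE lerN2; have := Qw l k; rewrite mxE.
by rewrite !mxE oppr_le0.
Qed.

Lemma vanishing_powers_unit (R : realType) n (Q : 'M[R]_n.+1) :
  vanishing_powers Q -> 1%:M - Q \in unitmx.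
Proof.
move=> Qv; rewrite unitmxE unitfE; apply/det0P => -[v v0].
rewrite mulmxBr mulmx1 => /subr0_eq vQ.
have vQm m : v = v *m Q ^+ m.
  by elim: m => [|m IH]; rewrite ?expr0 ?mulmx1 // exprSr mulmxA -IH.
apply/negP: v0; rewrite negbK; apply/eqP/rowP => j; rewrite mxE.
apply/normr0_eq0/le_anti; rewrite normr_ge0 andbT; apply/ler_addgt0Pr => e e0.
have [m Qm] := vanishing_powers_row v Qv e0.
by rewrite add0r (vQm m).
Qed.

(** The row [e = 1 (1 - Q)^-1].  Lowering [f] by a small multiple of [e] makes
    [f - f Q] strictly negative wherever [f] sits at its least allowed value;
    this turns constraints that are tight to first order into strict ones. *)
Lemma positive_left_witness (R : realType) n (Q : 'M[R]_n.+1) :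
  lemx 0 Q -> vanishing_powers Q ->
  exists e : 'rV[R]_n.+1, forall i, 0 < e 0 i /\ e 0 i - (e *m Q) 0 i = 1.
Proof.
move=> Q0 Qv; pose e : 'rV[R]_n.+1 := const_mx 1 *m invmx (1%:M - Q).
have eE i : e 0 i - (e *m Q) 0 i = 1.
  have -> : 1 = (e *m (1%:M - Q)) 0 i.
    by rewrite mulmxKV ?vanishing_powers_unit // mxE.
  by rewrite mulmxBr mulmx1 !mxE.
have e0 : lemx (- e) 0.
  apply: (vanishing_powers_subfix_row Q0 Qv) => i j.
  rewrite mulNmx ord1 [leLHS]mxE [leRHS]mxE lerN2; have := eE j; lra.
have e_ge0 j : 0 <= e 0 j by have := e0 0 j; rewrite !mxE oppr_le0.
exists e => i; split=> //.
have : 0 <= (e *m Q) 0 i.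
  rewrite mxE sumr_ge0 // => l _; rewrite mulr_ge0 //.
  by have := Q0 l i; rewrite mxE.
have := eE i; lra.
Qed.

(** * An improving direction at a point with a slack constraint *)

(** All that the improving direction needs to know about the exponent [k]: it
    allows [Q = A] and [S = 0] when [k = 1], [Q = A ^+ k] in general, and [Q = 0]
    when [k] is infinite, so that the three cases are treated at once. *)
Record certificate (R : realType) n (A S Q : 'M[R]_n.+1) (s : R) : Prop := Certificate {
  cert_id : (1%:M + S) *m (1%:M - A) = 1%:M - Q;
  cert_Q0 : lemx 0 Q;
  cert_Qv : vanishing_powers Q;
  cert_s : 0 <= s < 1;
  cert_S : forall i, \sum_j `|S i j| <= s }.


Lemma min0_nonexpansive (R : realType) (x y : R) :
  `|Num.min 0 (- x) - Num.min 0 (- y)| <= `|x - y|.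
Proof.
by case: (leP 0 (- x)) => h1; case: (leP 0 (- y)) => h2; rewrite ler_norml;
  case: (ltrgt0P (x - y)) => h3; apply/andP; split; lra.
Qed.

Lemma max_nonexpansive (R : realType) (a b x y : R) :
  `|Num.max a (b - x) - Num.max a (b - y)| <= `|x - y|.
Proof.
by case: (leP a (b - x)) => h1; case: (leP a (b - y)) => h2; rewrite ler_norml;
  case: (ltrgt0P (x - y)) => h3; apply/andP; split; lra.
Qed.

(** In this section [lo] and [up] are the coordinates of a feasible point that
    lie at the lower and the upper bound of the box; both hold at a coordinate
    where the bounds coincide.  The hypotheses on [A] and [S] are what the
    first-order conditions give, because a map of the box to itself that
    attains an upper bound is there maximal on the box. *)
Section Direction.
Variables (R : realType) (n : nat) (A S Q : 'M[R]_n.+1) (s : R).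
Variables (lo up : pred 'I_n.+1).
Hypothesis AS : certificate A S Q s.
Hypothesis S_fixed : forall l i, lo i -> up i -> ~~ (lo l && up l) -> S l i = 0.
Hypothesis A_up_int : forall l i, up i -> ~~ lo i -> ~~ lo l -> ~~ up l -> A l i = 0.
Hypothesis A_up_lo : forall l i, up i -> ~~ lo i -> lo l -> ~~ up l -> A l i <= 0.
Hypothesis A_up_up : forall l i, up i -> ~~ lo i -> ~~ lo l -> up l -> 0 <= A l i.

Lemma fixed_entry_zero (f : 'rV[R]_n.+1) i :
  (forall l, lo l -> up l -> f 0 l = 0) -> lo i -> up i -> (f *m S) 0 i = 0.
Proof.
move=> f0 loi upi; rewrite mxE big1 // => l _.
case: (boolP (lo l && up l)) => [/andP[lol upl]|/S_fixed -> //].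
  by rewrite f0 // mul0r.
by rewrite mulr0.
Qed.

Lemma certificate_mul (f : 'rV[R]_n.+1) :
  f + f *m S - (f + f *m S) *m A = f - f *m Q.
Proof.
have := congr1 (mulmx f) (cert_id AS).
by rewrite mulmxA [f *m (1%:M + S)]mulmxDr !mulmxBr !mulmx1.
Qed.

(** The block of [A] on the coordinates at an upper bound is nonnegative, and [p]
    shows it to have spectral radius at least 1 unless [p = 0].  For a contradiction,
    [p] is extended to a row [pi] such that [pi (1 + S)] equals [p] on this
    block and is nonpositive at the lower bounds.  Comparing
    [pi (1 + S) (1 - A)] with [pi (1 - Q)] gives [pi <= pi Q] on the block, so
    [pi <= 0] there; this forces the sum norm of [pi S] to be at least the sum
    of those of [pi] and [p], while the row sums of [S] are less than 1. *)
Lemma upper_block_zero (p : 'rV[R]_n.+1) :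
  (forall i, 0 <= p 0 i) -> (forall i, ~~ (up i && ~~ lo i) -> p 0 i = 0) ->
  (forall i, up i -> ~~ lo i -> p 0 i <= (p *m A) 0 i) -> p = 0.
Proof.
case: (AS) => _ Q0 Qv s01 Ss p0 p_supp pA.
pose phi i x := if up i && ~~ lo i then p 0 i - x
  else if lo i && ~~ up i then Num.min 0 (- x) else 0.
have [|pi piE] := @nonexpansive_fixed_point _ _ S s phi s01 Ss.
  move=> i x y; rewrite /phi; case: ifP => _.
    by rewrite distrC (_ : _ - _ = x - y) //; ring.
  by case: ifP => _; [exact: min0_nonexpansive | rewrite subrr normr0].
have pi_up i : up i -> ~~ lo i -> pi 0 i = p 0 i - (pi *m S) 0 i.
  by move=> ui li; rewrite piE /phi ui li.
have pi_lo i : lo i -> ~~ up i -> pi 0 i = Num.min 0 (- (pi *m S) 0 i).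
  by move=> li ui; rewrite piE /phi li (negbTE ui).
have pi_fixed i : lo i -> up i -> pi 0 i = 0.
  by move=> li ui; rewrite piE /phi li ui.
have pi_int i : ~~ lo i -> ~~ up i -> pi 0 i = 0.
  by move=> /negbTE li /negbTE ui; rewrite piE /phi li ui.
pose rho := pi + pi *m S.
have rhoE i : rho 0 i = pi 0 i + (pi *m S) 0 i by rewrite mxE.
have rhoA i : up i -> ~~ lo i -> (p *m A) 0 i <= (rho *m A) 0 i.
  move=> ui li; rewrite !mxE ler_sum // => l _; rewrite rhoE.
  case: (boolP (lo l)) => ll; case: (boolP (up l)) => ul.
  - rewrite pi_fixed // (fixed_entry_zero pi_fixed) // addr0.
    by rewrite p_supp // negb_and ll orbT.
  - rewrite p_supp ?negb_and ?ll ?orbT // mul0r mulr_le0 ?A_up_lo // pi_lo //.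
    by case: (leP 0 (- (pi *m S) 0 l)) => h; lra.
  - by rewrite pi_up // subrK.
  - by rewrite A_up_int // !mulr0.
have piQ i : up i -> ~~ lo i -> pi 0 i <= (pi *m Q) 0 i.
  move=> ui li; have /rowP/(_ i) := certificate_mul pi.
  rewrite -/rho [LHS]mxE [in RHS]mxE [(- (rho *m A)) _ _]mxE [(- (pi *m Q)) _ _]mxE.
  rewrite rhoE pi_up // subrK; have := rhoA i ui li; have := pA i ui li; lra.
pose q : 'rV[R]_n.+1 := \row_i if up i && ~~ lo i then Num.max 0 (pi 0 i) else 0.
have Qge l i : 0 <= Q l i by have := Q0 l i; rewrite mxE.
have q0 l : 0 <= q 0 l by rewrite mxE; case: ifP => // _; rewrite le_max lexx.
have pi_le_q l : pi 0 l <= q 0 l.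
  rewrite mxE; case: (boolP (lo l)) => ll; case: (boolP (up l)) => ul /=.
  - by rewrite pi_fixed.
  - by rewrite pi_lo // ge_min lexx.
  - by rewrite le_max lexx orbT.
  - by rewrite pi_int.
have pi_le0 i : up i -> ~~ lo i -> pi 0 i <= 0.
  have q_le0 : lemx q 0.
    apply: (vanishing_powers_subfix_row Q0 Qv) => j i'; rewrite ord1 {j}.
    have qQ0 : 0 <= (q *m Q) 0 i' by rewrite mxE sumr_ge0 // => l _; rewrite mulr_ge0.
    rewrite [leLHS]mxE; case: ifP => // /andP[ui li].
    rewrite ge_max qQ0 (le_trans (piQ _ ui li)) // !mxE ler_sum // => l _.
    exact: ler_wpM2r.
  by move=> ui li; rewrite (le_trans (pi_le_q i)) // (le_trans (q_le0 0 i)) // mxE.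
have : l1 pi + l1 p <= s * l1 pi.
  apply: le_trans (l1_mulmx_le pi Ss); rewrite -big_split ler_sum //= => i _.
  case: (boolP (lo i)) => li; case: (boolP (up i)) => ui.
  - by rewrite pi_fixed // p_supp ?negb_and ?li ?orbT // normr0 addr0.
  - rewrite p_supp ?negb_and ?li ?orbT // normr0 addr0 pi_lo //.
    have := min0_nonexpansive ((pi *m S) 0 i) 0.
    by rewrite oppr0 minxx subr0 addr0.
  - have := pi_le0 i ui li; have := pi_up i ui li; have := p0 i => h1 h2 h3.
    rewrite (ler0_norm h3) (ger0_norm h1) (le_trans _ (ler_norm _)) //; lra.
  - by rewrite pi_int // p_supp ?negb_and ?ui // normr0 addr0.
move=> h; apply: l1_eq0; have := l1_ge0 pi; move: s01 => /andP[? ?]; nra.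
Qed.

(** Each constraint [i] is preserved along [d] for one of three reasons: it is
    slack; it becomes slack to first order; or the coordinate stays at its lower
    bound, below which the values of a self-map of the box never fall. *)
Lemma improving_direction (c : 'cV[R]_n.+1) (sl : pred 'I_n.+1) j :
  (forall i, 0 < (c + S *m c) i 0) -> (forall i, sl i -> ~~ up i) -> sl j ->
  exists d : 'rV[R]_n.+1, 0 < (d *m c) 0 0 /\
   forall i, [/\ lo i -> 0 <= d 0 i, up i -> d 0 i <= 0 &
     [\/ sl i, d 0 i < (d *m A) 0 i | lo i /\ d 0 i = 0]].
Proof.
move=> W0 sl_up slj; case: (AS) => _ Q0 Qv s01 Ss.
have [e eE] := positive_left_witness Q0 Qv.
have e0 i : 0 < e 0 i by case: (eE i).
have eQ i : (e *m Q) 0 i = e 0 i - 1 by case: (eE i) => _ <-; rewrite subKr.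
pose W := c + S *m c; pose K := l1 e; pose eW := \sum_i e 0 i * W i 0.
pose kap := (\sum_i (W i 0)^-1)^-1.
have W0' i : 0 < W i 0 by exact: W0.
have sumV0 : 0 < \sum_i (W i 0)^-1.
  rewrite (bigD1 ord0) //= ltr_pwDl ?invr_gt0 // sumr_ge0 // => i _.
  by rewrite invr_ge0 ltW.
have kap0 : 0 < kap by rewrite invr_gt0.
have kapW i : kap <= W i 0.
  rewrite -[leRHS]invrK lef_pV2 ?posrE ?invr_gt0 //.
  by rewrite (bigD1 i) //= lerDl sumr_ge0 // => l _; rewrite invr_ge0 ltW.
have K0 : 0 <= K by exact: l1_ge0.
have eW0 : 0 <= eW by apply: sumr_ge0 => i _; rewrite mulr_ge0 ?ltW.
(* The step [ep] keeps [ep * K <= 1 / 2], so that the positive part of [f] has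
   sum at least 1 / 4, and makes the loss [ep * eW] smaller than the gain, which
   is then at least [kap / 4]. *)
pose M := 2 * K + 8 * eW / kap + 1.
have M0 : 0 < M by rewrite ltr_wpDl // addr_ge0 ?divr_ge0 ?mulr_ge0 // ltW.
pose ep := M^-1; have ep0 : 0 < ep by rewrite invr_gt0.
have epK : ep * K <= 1 / 2.
  rewrite mulrC ler_pdivrMr // /M.
  have : 0 <= 8 * eW / kap by rewrite divr_ge0 ?mulr_ge0 // ltW.
  lra.
have epW : ep * eW <= kap / 8.
  rewrite mulrC ler_pdivrMr // /M !mulrDr.
  have -> : kap / 8 * (8 * eW / kap) = eW by field; rewrite lt0r_neq0.
  have : 0 <= kap / 8 * (2 * K) by rewrite mulr_ge0 ?divr_ge0 ?mulr_ge0 // ltW.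
  lra.
(* At a lower bound the maximum makes [f + f S] nonnegative, and at least 1 if the
   constraint is slack, which excludes [f = 0]; if the constraint is tight and the
   maximum is not [- ep * e i], this coordinate of [d] vanishes. *)
pose phi i x := if lo i && up i then 0
  else if lo i then Num.max (- (ep * e 0 i)) ((sl i)%:R - x)
  else if sl i then 1 else - (ep * e 0 i).
have [|f fE] := @nonexpansive_fixed_point _ _ S s phi s01 Ss.
  move=> i x y; rewrite /phi; case: ifP => _; first by rewrite subrr normr0.
  case: ifP => _; first exact: max_nonexpansive.
  by case: ifP => _; rewrite subrr normr0.
have f_fixed i : lo i -> up i -> f 0 i = 0.
  by move=> li ui; rewrite fE /phi li ui.
have f_lo i : lo i -> ~~ up i ->
    f 0 i = Num.max (- (ep * e 0 i)) ((sl i)%:R - (f *m S) 0 i).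
  by move=> li /negbTE ui; rewrite fE /phi li ui.
have f_free i : ~~ lo i -> f 0 i = if sl i then 1 else - (ep * e 0 i).
  by move=> /negbTE li; rewrite fE /phi li.
have epe i : 0 < ep * e 0 i by rewrite mulr_gt0.
have f_ge i : - (ep * e 0 i) <= f 0 i.
  case: (boolP (lo i)) => li; last first.
    by rewrite f_free //; case: ifP => _ //; have := epe i; lra.
  case: (boolP (up i)) => ui; first by rewrite f_fixed //; have := epe i; lra.
  by rewrite f_lo // le_max lexx.
have fQ i : f 0 i = - (ep * e 0 i) -> f 0 i < (f *m Q) 0 i.
  move=> fi; have : - (ep * (e *m Q) 0 i) <= (f *m Q) 0 i.
    rewrite !mxE mulr_sumr -sumrN ler_sum // => l _.
    rewrite mulrA -mulNr ler_wpM2r //.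
    by have := Q0 l i; rewrite mxE.
  by rewrite eQ fi; lra.
pose d := f + f *m S.
have dE i : d 0 i = f 0 i + (f *m S) 0 i by rewrite mxE.
have dA i : d 0 i - (d *m A) 0 i = f 0 i - (f *m Q) 0 i.
  have /rowP/(_ i) := certificate_mul f.
  by rewrite -/d [LHS]mxE [in RHS]mxE [(- (d *m A)) _ _]mxE [(- (f *m Q)) _ _]mxE.
have d_fixed i : lo i -> up i -> d 0 i = 0.
  by move=> li ui; rewrite dE f_fixed // (fixed_entry_zero f_fixed) // addr0.
have d_lo i : lo i -> 0 <= d 0 i.
  move=> li; case: (boolP (up i)) => ui; first by rewrite d_fixed.
  rewrite dE f_lo //; have : (0 : R) <= (sl i)%:R by [].
  by case: (leP _ ((sl i)%:R - (f *m S) 0 i)) => h; lra.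
have d_or i : [\/ sl i, d 0 i < (d *m A) 0 i | lo i /\ d 0 i = 0].
  case: (boolP (sl i)) => sli; first by constructor 1.
  case: (boolP (lo i)) => li; last first.
    constructor 2; have := dA i; have := fQ i; rewrite f_free // (negbTE sli).
    by move=> /(_ erefl); lra.
  case: (boolP (up i)) => ui; first by constructor 3; rewrite d_fixed.
  have := f_lo i li ui; rewrite (negbTE sli); case: (leP _ (0 - (f *m S) 0 i)) => h fi.
    by constructor 3; rewrite dE fi; split=> //; rewrite add0r addNr.
  by constructor 2; have := dA i; have := fQ i fi; lra.
exists d; split; last first.
  move=> i; split=> //; first exact: d_lo.
  move=> ui; case: (boolP (lo i)) => li; first by rewrite d_fixed.
  pose p : 'rV[R]_n.+1 := \row_i if up i && ~~ lo i then Num.max 0 (d 0 i) else 0.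
  have p0 l : 0 <= p 0 l by rewrite mxE; case: ifP => // _; rewrite le_max lexx.
  suff /rowP/(_ i) : p = 0.
    by rewrite [LHS]mxE ui li /= [RHS]mxE => <-; rewrite le_max lexx orbT.
  apply: upper_block_zero => // [l /negbTE|l ul ll]; first by rewrite mxE => ->.
  have pA0 : 0 <= (p *m A) 0 l.
    rewrite mxE sumr_ge0 // => k _; case: (boolP (up k && ~~ lo k)) => kk.
      by case/andP: kk => uk lk; rewrite mulr_ge0 // A_up_up.
    by rewrite mxE (negbTE kk) mul0r.
  rewrite [leLHS]mxE ul ll /= ge_max pA0 /=.
  have [sll|dl|[lol _]] := d_or l; first by have := sl_up _ sll; rewrite ul.
    rewrite (le_trans (ltW dl)) // [leLHS]mxE [leRHS]mxE ler_sum // => k _.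
    rewrite [p _ _]mxE.
    case: (boolP (lo k)) => lk; case: (boolP (up k)) => uk /=.
    - by rewrite d_fixed.
    - by rewrite mul0r mulr_ge0_le0 ?d_lo // A_up_lo.
    - by rewrite ler_wpM2r ?A_up_up // le_max lexx orbT.
    - by rewrite A_up_int // !mulr0.
  by rewrite lol in ll.
have -> : (d *m c) 0 0 = \sum_i f 0 i * W i 0.
  rewrite (_ : d *m c = f *m W); first by rewrite mxE.
  by rewrite /d /W mulmxDl mulmxDr mulmxA.
pose fp i := Num.max 0 (f 0 i).
have fp0 i : 0 <= fp i by rewrite le_max lexx.
have f_le i : f 0 i <= fp i by rewrite le_max lexx orbT.
have fp_ge i : fp i - ep * e 0 i <= f 0 i.
  by rewrite /fp; case: (leP 0 (f 0 i)) => h; have := epe i; have := f_ge i; lra.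
have f_abs i : `|f 0 i| <= fp i + ep * e 0 i.
  rewrite ler_norml; apply/andP; split; have := fp0 i; have := f_ge i; have := f_le i;
  have := epe i; lra.
pose F := \sum_i fp i.
have fpF i : fp i <= F by rewrite /F (bigD1 i) //= lerDl sumr_ge0.
have KE : \sum_i ep * e 0 i = ep * K.
  by rewrite -mulr_sumr; congr (_ * _); apply: eq_bigr => i _; rewrite gtr0_norm.
have F4 : 1 / 4 <= F.
  case: (boolP (lo j)) => lj; last first.
    by have := fpF j; have := f_le j; rewrite f_free // slj; lra.
  have fj : 1 - (f *m S) 0 j <= f 0 j.
    by rewrite f_lo ?sl_up // slj le_max lexx orbT.
  have l1f : l1 f <= F + ep * K.
    by rewrite -KE -big_split ler_sum.
  have : (f *m S) 0 j <= l1 f.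
    apply: (@le_trans _ _ (l1 (f *m S))).
      by rewrite /l1 (bigD1 j) //= ler_wpDr ?sumr_ge0 // ler_norm.
    rewrite (le_trans (l1_mulmx_le f Ss)) // ler_piMl ?l1_ge0 //.
    by case/andP: s01 => _ /ltW.
  by have := fpF j; have := f_le j; lra.
have : kap * F - ep * eW <= \sum_i f 0 i * W i 0.
  rewrite !mulr_sumr -sumrB ler_sum // => i _.
  apply: (@le_trans _ _ ((fp i - ep * e 0 i) * W i 0)); last by rewrite ler_wpM2r // ltW.
  by rewrite mulrBl mulrA lerB // mulrC ler_wpM2l.
nra.
Qed.
End Direction.


(** * Submultiplicative matrix norms and Neumann series *)

Section SubmultiplicativeNorm.
Variables (R : realType) (n : nat) (N : 'M[R]_n.+1 -> R).
Hypothesis normN : submul_matrix_norm N.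

Lemma submul_norm0 : N 0 = 0.
Proof.
by case: normN => _ NZ _ _; have := NZ 0 0; rewrite scale0r normr0 mul0r.
Qed.

Lemma submul_normN B : N (- B) = N B.
Proof. by case: normN => _ NZ _ _; rewrite -scaleN1r NZ normrN1 mul1r. Qed.

Lemma submul_norm_ge0 B : 0 <= N B.
Proof.
case: normN => _ _ ND _; have := ND B (- B).
by rewrite subrr submul_norm0 submul_normN; lra.
Qed.

Lemma submul_norm_gt0 B : B != 0 -> 0 < N B.
Proof.
case: normN => N0 _ _ _ B0; rewrite lt_neqAle submul_norm_ge0 andbT eq_sym.
by apply: contraNneq B0 => /N0 ->.
Qed.

Lemma submul_norm_exp B p : N (B ^+ p.+1) <= N B ^+ p.+1.
Proof.
case: normN => _ _ _ NM; elim: p => [|p IH]; first by rewrite !expr1.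
rewrite exprS [leRHS]exprS (le_trans (NM _ _)) // ler_wpM2l //.
exact: submul_norm_ge0.
Qed.

(** Multiplying [B] by matrix units on both sides isolates one of its entries,
    so submultiplicativity alone compares [N] with the entries. *)
Lemma entry_le_submul_norm : exists2 K, 0 < K & forall B, `|B| <= K * N B.
Proof.
case: normN => _ NZ _ NM.
pose E i j : 'M[R]_n.+1 := delta_mx i j.
have NE i j : 0 < N (E i j).
  apply: submul_norm_gt0; apply/eqP => /matrixP/(_ i j).
  by rewrite !mxE !eqxx /= => /eqP; rewrite oner_eq0.
pose k i j := N (E 0 i) * N (E j 0) / N (E 0 0).
have k0 i j : 0 < k i j by rewrite divr_gt0 ?mulr_gt0.
pose K := \sum_i \sum_j k i j.
have kK i j : k i j <= K.
  rewrite /K (bigD1 i) //= (bigD1 j) //= -addrA lerDl addr_ge0 //.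
    by apply: sumr_ge0 => l _; rewrite ltW.
  by apply: sumr_ge0 => l _; apply: sumr_ge0 => l' _; rewrite ltW.
have K0 : 0 < K by apply: lt_le_trans (kK 0 0).
exists K => // B; apply: norm_le_entries => [|i j].
  by rewrite mulr_ge0 ?submul_norm_ge0 // ltW.
rewrite (@le_trans _ _ (k i j * N B)) ?ler_wpM2r ?submul_norm_ge0 //.
have EBE : B i j *: E 0 0 = E 0 i *m B *m E j 0.
  have EB a b : (E 0 i *m B) a b = (a == 0)%:R * B i b.
    rewrite mxE (bigD1 i) //= big1 ?addr0 => [|l /negbTE li].
      by rewrite mxE eqxx andbT.
    by rewrite mxE li andbF mul0r.
  apply/matrixP => a b; rewrite [RHS]mxE (bigD1 j) //= big1 ?addr0 => [|l /negbTE lj].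
    by rewrite EB !mxE eqxx /= -mulnb natrM mulrA (mulrC (B i j)).
  by rewrite [E j 0 l b]mxE lj mulr0.
rewrite /k mulrAC ler_pdivlMr // -NZ EBE.
rewrite (le_trans (NM _ _)) // [leRHS]mulrAC ler_wpM2r ?NM //.
exact: submul_norm_ge0.
Qed.

Lemma submul_norm_powers B : N B < 1 ->
  forall e, 0 < e -> \forall p \near \oo, `|B ^+ p| <= e.
Proof.
move=> NB1 e e0; have [K K0 leK] := entry_le_submul_norm.
have : `|N B| < 1 by rewrite ger0_norm ?submul_norm_ge0.
move=> /cvg_expr /cvgrPdist_le /(_ (e / K)) [|p0 _ Np]; first exact: divr_gt0.
exists p0.+1 => // -[//|p] /= lt_p.
rewrite (le_trans (leK _)) // mulrC -ler_pdivlMr //.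
rewrite (le_trans (submul_norm_exp _ _)) //.
have := Np p.+1 (ltnW lt_p); rewrite sub0r normrN ger0_norm //.
by rewrite exprn_ge0 // submul_norm_ge0.
Qed.

Lemma submul_norm_vanishing B : N B < 1 -> vanishing_powers B.
Proof.
move=> NB1 e e0; have [p _ Bp] := submul_norm_powers NB1 e0.
by exists p => i j; rewrite (le_trans (entry_le_norm _ _ _)) // Bp /=.
Qed.

Lemma geometric_sum (B : 'M[R]_n.+1) p :
  (1%:M + \sum_(1 <= l < p.+1) B ^+ l) *m (1%:M - B) = 1%:M - B ^+ p.+1.
Proof.
elim: p => [|p IH]; first by rewrite big_nil addr0 mul1mx expr1.
rewrite big_nat_recr //= addrA mulmxDl IH mulmxBr mulmx1.
by rewrite [B ^+ p.+2]exprSr mulmxE addrA subrK.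
Qed.

Lemma power_sum_cvg (B : 'M[R]_n.+1) : N B < 1 ->
  (fun p => \sum_(1 <= l < p) B ^+ l) @ \oo --> invmx (1%:M - B) - 1%:M.
Proof.
move=> NB1; set L := invmx _.
have uB := vanishing_powers_unit (submul_norm_vanishing NB1).
apply/cvgrPdist_le => e e0.
have E0 : 0 < entry_sum L + 1 by rewrite ltr_wpDl // entry_sum_ge0.
have [p0 _ Bp] := submul_norm_powers NB1 (divr_gt0 e0 E0).
exists p0.+1 => // -[//|p] /= lt_p.
have -> : L - 1%:M - \sum_(1 <= l < p.+1) B ^+ l = B ^+ p.+1 *m L.
  have := congr1 (mulmxr L) (geometric_sum B p); rewrite /= mulmxK // mulmxBl mul1mx.
  by move=> h; rewrite -addrA -opprD h opprB addrC subrK.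
rewrite (le_trans (norm_mulmx_le _ _)) //.
rewrite (@le_trans _ _ (e / (entry_sum L + 1) * entry_sum L)) //.
  by rewrite ler_wpM2r ?entry_sum_ge0 // Bp //= ltnW.
rewrite mulrAC -mulrA ger_pMr // ler_pdivrMr // mul1r; lra.
Qed.

Lemma power_sum_infty (B : 'M[R]_n.+1) : N B < 1 ->
  power_sum B None = invmx (1%:M - B) - 1%:M.
Proof. by move=> NB1; apply/cvg_lim/power_sum_cvg. Qed.

End SubmultiplicativeNorm.


(** * From the qualifying condition to a certificate *)

Lemma ord_min_le (R : realType) n (F : 'I_n.+1 -> R) i : ord_min F <= F i.
Proof. exact: bigmin_le. Qed.

Lemma le_ord_max (R : realType) n (F : 'I_n.+1 -> R) i : F i <= ord_max F.
Proof. exact: le_bigmax. Qed.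

Lemma row_sum_le_norm_infty (R : realType) m n (A : 'M[R]_(m, n)) i :
  \sum_j `|A i j| <= norm_infty A.
Proof. exact: (le_bigmax 0 (fun i => \sum_j `|A i j|) i). Qed.

Lemma norm_infty_ge0 (R : realType) m n (A : 'M[R]_(m, n)) : 0 <= norm_infty A.
Proof. exact: bigmax_ge_id. Qed.

Lemma mulmx_entry_bound (R : realType) m n p (A : 'M[R]_(m, n)) (B : 'M[R]_(n, p)) i j b :
  0 <= b -> (forall l, `|B l j| <= b) -> `|(A *m B) i j| <= norm_infty A * b.
Proof.
move=> b0 Bb; rewrite mxE (le_trans (ler_norm_sum _ _ _)) //.
apply: (@le_trans _ _ ((\sum_l `|A i l|) * b)).
  by rewrite mulr_suml ler_sum // => l _; rewrite normrM ler_wpM2l.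
by rewrite ler_wpM2r // row_sum_le_norm_infty.
Qed.

Lemma lt_q_ratio (R : realType) n m (G : 'M[R]_(n.+1, m.+1)) s j :
  lemx 0 G -> 0 <= s -> s < q_ratio G ->
  0 < ord_max (fun i => G i j) /\ s * ord_max (fun i => G i j) < ord_min (fun i => G i j).
Proof.
move=> G0 s0 s_lt; set M := ord_max _; set mi := ord_min _.
have {}s_lt : s < mi / M by rewrite (lt_le_trans s_lt) // /q_ratio ord_min_le.
have M0 : 0 <= M.
  by rewrite (le_trans _ (le_ord_max _ ord0)) //; have := G0 ord0 j; rewrite mxE.
have {M0} : 0 < M.
  rewrite lt_neqAle M0 andbT; apply: contraTneq s_lt => <-.
  by rewrite invr0 mulr0 -leNgt.
by split; rewrite // -ltr_pdivlMr.
Qed.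

Lemma lt_q_ratio_lt1 (R : realType) n m (G : 'M[R]_(n.+1, m.+1)) s :
  lemx 0 G -> 0 <= s -> s < q_ratio G -> s < 1.
Proof.
move=> G0 s0 /(lt_q_ratio 0 G0 s0)[M0 lt_sM].
rewrite -(ltr_pM2r M0) mul1r (lt_le_trans lt_sM) //.
exact: le_trans (ord_min_le _ ord0) (le_ord_max _ ord0).
Qed.

(** Entry [(i, j)] of [S G] is at least minus the norm of [S] times the largest
    entry of column [j], hence larger than minus the smallest one. *)
Lemma dominated_perturbation_gt0 (R : realType) n m (G : 'M[R]_(n.+1, m.+1))
    (S : 'M[R]_n.+1) i j :
  lemx 0 G -> norm_infty S < q_ratio G -> 0 < (G + S *m G) i j.
Proof.
move=> G0 SG; have [M0 lt_sM] := lt_q_ratio j G0 (norm_infty_ge0 S) SG.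
have le_GM l : `|G l j| <= ord_max (fun i => G i j).
  rewrite ger0_norm ?(le_ord_max (fun i => G i j)) //.
  by have := G0 l j; rewrite mxE.
have := @mulmx_entry_bound _ _ _ _ S G i j _ (ltW M0) le_GM.
rewrite ler_norml => /andP[ge_SG _]; rewrite mxE.
have := ord_min_le (fun i => G i j) i; lra.
Qed.

(** Row vectors that vanish on [D] form a subspace; this says that right
    multiplication by [A] preserves it, which passes to powers and limits. *)
Definition preserves_zeros (R : realType) n (D : pred 'I_n) (A : 'M[R]_n) : Prop :=
  forall l i, ~~ D l -> D i -> A l i = 0.

Lemma preserves_zeros_exp (R : realType) n (D : pred 'I_n.+1) (A : 'M[R]_n.+1) p :
  preserves_zeros D A -> preserves_zeros D (A ^+ p).
Proof.
move=> DA; elim: p => [|p IH] l i nDl Di.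
  by rewrite expr0 mxE; case: eqP => // li; rewrite li Di in nDl.
rewrite exprS mxE big1 // => k _; case: (boolP (D k)) => Dk.
  by rewrite DA ?mul0r.
by rewrite IH ?mulr0.
Qed.

Lemma preserves_zeros_sum (R : realType) n (D : pred 'I_n.+1) (A : 'M[R]_n.+1) p :
  preserves_zeros D A -> preserves_zeros D (\sum_(1 <= l < p) A ^+ l).
Proof.
move=> DA l i nDl Di; rewrite summxE big1 // => k _.
exact: (preserves_zeros_exp k DA).
Qed.

Lemma preserves_zeros_power_sum (R : realType) n (N : 'M[R]_n.+1 -> R)
    (D : pred 'I_n.+1) (A : 'M[R]_n.+1) k :
  submul_matrix_norm N -> N A < 1 ->
  preserves_zeros D A -> preserves_zeros D (power_sum A k).
Proof.
move=> normN NA1 DA; case: k => [p|]; first exact: preserves_zeros_sum.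
move=> l i nDl Di; rewrite (power_sum_infty normN NA1).
have := power_sum_cvg normN NA1; move: (_ - _) => L /cvgrPdist_le cvL.
apply/normr0_eq0/le_anti; rewrite normr_ge0 andbT; apply/ler_addgt0Pr => e e0.
have [p _ /(_ p (leqnn p)) /=] := cvL e e0.
move=> /(le_trans (entry_le_norm _ l i)); rewrite add0r.
have -> : (L - \sum_(1 <= l < p) A ^+ l) l i = L l i; last by [].
by rewrite mxE [X in _ + X]mxE (preserves_zeros_sum p DA) // subr0.
Qed.

Lemma nonneg_row_pos_entry (R : realType) n m (M : 'M[R]_(n, m)) i :
  lemx 0 M -> nonzero_rows M -> exists j, 0 < M i j.
Proof.
move=> M0 Mrow; have /existsP[j Mij] : [exists j, M i j != 0].
  apply: contraNT (Mrow i); rewrite negb_exists => /forallP M_i0.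
  by apply/eqP/rowP => j; rewrite !mxE; apply/eqP; have := M_i0 j; rewrite negbK.
by exists j; rewrite lt_neqAle eq_sym Mij; have := M0 i j; rewrite mxE.
Qed.

(** For [k > 1] the strict inequality against [q_ratio] makes all of [G + S G]
    positive; for [k = 1] one takes [S = 0] and only the rows of [G] are known
    to be nonzero, whence the form of the last conclusion. *)
Lemma qualifying_certificate (R : realType) n m (N : 'M[R]_n.+1 -> R)
    (A : 'M[R]_n.+1) (G : 'M[R]_(n.+1, m.+1)) (k : option nat) :
  submul_matrix_norm N -> N A < 1 -> lemx 0 G -> nonzero_rows G ->
  k <> Some 0%N -> (forall p, k = Some p -> lemx 0 (A ^+ p)) ->
  (k <> Some 1%N -> norm_infty (power_sum A k) < q_ratio G) ->
  exists S Q s, [/\ certificate A S Q s,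
    forall D, preserves_zeros D A -> preserves_zeros D S,
    lemx 0 (G + S *m G) &
    forall i, exists j, 0 < (G + S *m G) i j].
Proof.
move=> normN NA1 G0 Grow k0 Ak qk.
have [k1|/eqP k1] := eqVneq k (Some 1%N).
  exists 0, A, 0; split.
  - split.
    + by rewrite addr0 mul1mx.
    + by have := Ak _ k1; rewrite expr1.
    + exact: (submul_norm_vanishing normN).
    + by rewrite lexx ltr01.
    + by move=> i; rewrite big1 // => j _; rewrite mxE normr0.
  - by move=> D _ l i _ _; rewrite mxE.
  - by rewrite mul0mx addr0.
  move=> i; rewrite mul0mx addr0.
  exact: nonneg_row_pos_entry.
have {}qk := qk k1.
have gt0 i j := dominated_perturbation_gt0 i j G0 qk.
have s1 := lt_q_ratio_lt1 G0 (norm_infty_ge0 _) qk.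
exists (power_sum A k), (if k is Some p then A ^+ p else 0), (norm_infty (power_sum A k)).
split.
- split.
  + case: k k0 k1 {Ak qk gt0 s1} => [[//|p]|] _ _; first exact: geometric_sum.
    rewrite (power_sum_infty normN NA1) addrC subrK subr0 mulVmx //.
    exact/vanishing_powers_unit/(submul_norm_vanishing normN).
  + case: k Ak {k0 k1 qk gt0 s1} => [p|] Ak; first exact: Ak.
    by move=> i j; rewrite !mxE.
  + case: k k0 {Ak k1 qk gt0 s1} => [[//|p]|] _; last first.
      by move=> e e0; exists 1%N => i j; rewrite expr1 mxE normr0 ltW.
    apply: (submul_norm_vanishing normN).
    rewrite (le_lt_trans (submul_norm_exp normN _ _)) // exprn_ilt1 //.
    exact: submul_norm_ge0.
  + by rewrite norm_infty_ge0.
  + by move=> i; exact: row_sum_le_norm_infty.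
- by move=> D; exact: (preserves_zeros_power_sum k normN).
- by move=> i j; rewrite mxE ltW.
- by move=> i; exists 0.
Qed.


(** * Fixed points of maps whose gradients have norm less than 1 *)

Lemma expands_line (R : realType) m n (F : 'rV[R]_m -> 'rV[R]_n) x G v e :
  expands F x G -> 0 < e ->
  \forall t \near 0^'+, `|F (x + t *: v) - F x - t *: (v *m G)| <= e * t.
Proof.
move=> xF e0; have v0 : 0 < `|v| + 1 by rewrite ltr_wpDl.
have /nbhs_ballP[d /= d0 dF] := xF _ (divr_gt0 e0 v0).
near=> t.
have t0 : 0 < t by near: t; exact: nbhs_right_gt.
have td : t < d / (`|v| + 1) by near: t; apply: nbhs_right_lt; exact: divr_gt0.
have ntv : `|t *: v| = t * `|v| by rewrite normrZ gtr0_norm.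
have := dF (t *: v); rewrite -ball_normE /= sub0r normrN ntv -scalemxAl.
move=> /(_ _)/le_trans; apply.
  rewrite ltr_pdivlMr // in td; rewrite (le_lt_trans _ td) // ler_wpM2l ?ltW //; lra.
rewrite mulrAC ler_pdivrMr // -[leRHS]mulrA.
by rewrite ler_pM2l // ler_pM2l // lerDl.
Unshelve. all: by end_near. Qed.

Lemma box_compact (R : realType) n (a b : 'rV[R]_n) : compact (box a b).
Proof.
have -> : box a b = [set v | forall i, `[a 0 i, b 0 i]%classic (v 0 i)].
  apply/seteqP; split => v /=.
    by move=> [av vb] i; rewrite /= in_itv /= av vb.
  by move=> vab; split=> j i; rewrite ord1; have := vab i; rewrite /= in_itv => /andP[].
apply: (@rV_compact _ _ (fun i => `[a 0 i, b 0 i]%classic)) => i.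
exact: segment_compact.
Qed.

Section VectorNorm.
Variables (R : realType) (n : nat) (N : 'M[R]_n.+1 -> R).
Hypothesis normN : submul_matrix_norm N.

(** The row is placed in a square matrix, so that the submultiplicativity of [N]
    bounds the action of a matrix on rows. *)
Definition row_norm (v : 'rV[R]_n.+1) : R := N ((delta_mx 0 0 : 'cV_n.+1) *m v).

Lemma row_normZ a v : row_norm (a *: v) = `|a| * row_norm v.
Proof. by case: normN => _ NZ _ _; rewrite /row_norm -scalemxAr NZ. Qed.

Lemma row_norm_ge0 v : 0 <= row_norm v.
Proof. exact: submul_norm_ge0. Qed.

Lemma row_norm_gt0 v : v != 0 -> 0 < row_norm v.
Proof.
move=> v0; apply: submul_norm_gt0 => //; apply: contraNneq v0 => /matrixP v0.
apply/eqP/rowP => j; have := v0 0 j.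
by rewrite !mxE big_ord1 mxE !eqxx mul1r.
Qed.

Lemma le_row_normD u v : row_norm (u + v) <= row_norm u + row_norm v.
Proof. by case: normN => _ _ ND _; rewrite /row_norm mulmxDr. Qed.

Lemma row_norm_mulmx v A : row_norm (v *m A) <= row_norm v * N A.
Proof. by case: normN => _ _ _ NM; rewrite /row_norm mulmxA. Qed.

Lemma row_norm_le_norm : exists2 C, 0 < C & forall v, row_norm v <= C * `|v|.
Proof.
pose C := 1 + \sum_j row_norm (delta_mx 0 j).
have C0 : 0 < C by rewrite ltr_wpDr // sumr_ge0 // => j _; exact: row_norm_ge0.
exists C => // v.
apply: (@le_trans _ _ (\sum_j `|v 0 j| * row_norm (delta_mx 0 j))).
  rewrite [in leLHS](row_sum_delta v).
  elim/big_ind2: _ => [|u a w b ua wb|j _].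
  - by rewrite -[X in row_norm X](scale0r (0 : 'rV[R]_n.+1)) row_normZ normr0 mul0r.
  - by rewrite (le_trans (le_row_normD _ _)) // lerD.
  - by rewrite row_normZ.
rewrite /C mulrDl mul1r ler_wpDl // mulr_suml ler_sum // => j _.
by rewrite mulrC ler_wpM2l ?row_norm_ge0 // entry_le_norm.
Qed.

Lemma row_norm_continuous : continuous row_norm.
Proof.
have [C C0 leC] := row_norm_le_norm.
apply: (lipschitz_continuous C0) => u v.
rewrite (le_trans _ (leC _)) // ler_norml.
have := le_row_normD (u - v) v; have := le_row_normD (v - u) u.
have -> : row_norm (v - u) = row_norm (u - v).
  by rewrite -opprB -scaleN1r row_normZ normrN1 mul1r.
by rewrite !subrK => h1 h2; apply/andP; split; lra.
Qed.

End VectorNorm.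

Section ContractionFixedPoint.
Variables (R : realType) (n : nat) (N : 'M[R]_n.+1 -> R).
Variables (a b : 'rV[R]_n.+1) (h : 'rV[R]_n.+1 -> 'rV[R]_n.+1).
Hypothesis normN : submul_matrix_norm N.
Hypothesis h_diff : forall y, differentiable h y.
Hypothesis h_contr : forall y, box a b y -> N (grad h y) < 1.

Let h_cont : continuous h.
Proof. by move=> y; exact: differentiable_continuous. Qed.

Lemma box_convex y r t : box a b y -> box a b (y + r) -> 0 <= t <= 1 ->
  box a b (y + t *: r).
Proof.
move=> [ay yb] [ar rb] /andP[t0 t1]; split=> i j; rewrite !mxE.
- have := ay i j; have := ar i j; rewrite !mxE; nra.
- have := yb i j; have := rb i j; rewrite !mxE; nra.
Qed.

(** Here [q] is the image of [r] under the gradient, and the strict inequality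
    between the norms of [q] and [r] leaves room for the remainder. *)
Lemma contraction_line y r : box a b y -> r != 0 ->
  exists q g, [/\ 0 < g, row_norm N q + 2 * g <= row_norm N r &
    \forall t \near 0^'+, row_norm N (h (y + t *: r) - h y - t *: q) <= t * g].
Proof.
move=> yab r0; have [C C0 leC] := row_norm_le_norm normN.
pose q := r *m grad h y; pose g := (row_norm N r - row_norm N q) / 2.
have g0 : 0 < g.
  have lt_qr : row_norm N q < row_norm N r.
    rewrite (le_lt_trans (row_norm_mulmx normN _ _)) // gtr_pMr ?h_contr //.
    exact: row_norm_gt0.
  by rewrite divr_gt0 // subr_gt0.
exists q, g; split=> //; first by rewrite /g; lra.
near=> t; rewrite (le_trans (leC _)) // -ler_pdivlMl // mulrA mulrAC.
near: t; apply: expands_line (differentiable_expands (h_diff y)) _.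
by rewrite mulrC divr_gt0.
Unshelve. all: by end_near. Qed.

Hypothesis le_ab : lemx a b.
Hypothesis h_self : forall y, box a b y -> box a b (h y).

(** At a minimizer [y] of the residual norm, moving by [t (h y - y)] would decrease
    the residual at a positive rate if it were nonzero. *)
Lemma contraction_fixed_point : exists2 y, box a b y & h y = y.
Proof.
have box0 : box a b !=set0 by exists a; split=> // i j.
have resC : continuous (fun y => row_norm N (h y - y)).
  move=> y; apply: (@continuous_comp _ _ _ (fun y => h y - y)).
    by apply: continuousB; [exact: h_cont | exact: cvg_id].
  exact: row_norm_continuous.
have [y yab miny] := compact_argmin box0 (@box_compact _ _ a b) resC.
exists y => //; apply/eqP; rewrite -subr_eq0; apply/negPn/negP => r0.
have [q [g [g0 qg near_q]]] := contraction_line yab r0.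
set r := h y - y in r0 qg near_q.
have [t [[t0 t1] qt]] : exists t, (0 < t /\ t <= 1) /\
    row_norm N (h (y + t *: r) - h y - t *: q) <= t * g.
  apply: (@filter_ex _ 0^'+); near=> t; split; last by near: t.
  by split; near: t; [exact: nbhs_right_gt | exact: nbhs_right_le].
have ytab : box a b (y + t *: r).
  apply: box_convex => //; last by rewrite ltW.
  by rewrite /r addrC subrK; exact: h_self.
have := miny _ ytab; apply/negP; rewrite -ltNge.
have -> : h (y + t *: r) - (y + t *: r) =
    (h (y + t *: r) - h y - t *: q) + ((1 - t) *: r + t *: q).
  rewrite scalerBl scale1r {4}/r; apply/rowP => j; rewrite !mxE; ring.
rewrite (le_lt_trans (le_row_normD normN _ _)) //.
have : row_norm N ((1 - t) *: r + t *: q) <= (1 - t) * row_norm N r + t * row_norm N q.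
  rewrite (le_trans (le_row_normD normN _ _)) // !row_normZ // (ger0_norm (ltW t0)).
  by rewrite ger0_norm // subr_ge0.
rewrite -/r; nra.
Unshelve. all: by end_near. Qed.

(** With [v = y1 - y0], the distance from [h y0] to [h (y0 + t v)] minus [t] times
    the norm of [v] has a smaller value to the right of each [t < 1], so its
    minimum over the unit interval is attained at 1 only; at two fixed points it
    would take the same value 0 at both ends. *)
Lemma contraction_fixed_point_unique y0 y1 :
  box a b y0 -> box a b y1 -> h y0 = y0 -> h y1 = y1 -> y0 = y1.
Proof.
move=> y0ab y1ab hy0 hy1; apply/eqP; rewrite eq_sym -subr_eq0; apply/negPn/negP => v0.
set v := y1 - y0 in v0.
pose th t := row_norm N (h (y0 + t *: v) - h y0) - t * row_norm N v.
have yt t : 0 <= t <= 1 -> box a b (y0 + t *: v).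
  by move=> ?; apply: box_convex => //; rewrite addrC subrK.
have decr t : 0 <= t < 1 -> exists2 u, t < u <= 1 & th u < th t.
  move=> /andP[t0 t1]; have t01 : 0 <= t <= 1 by rewrite t0 ltW.
  have [q [g [g0 qg near_q]]] := contraction_line (yt _ t01) v0.
  have : \forall s \near 0^'+, t < t + s <= 1 /\ th (t + s) < th t.
    near=> s; have s0 : 0 < s by near: s; exact: nbhs_right_gt.
    have s1 : s <= 1 - t by near: s; apply: nbhs_right_le; rewrite subr_gt0.
    split; first by apply/andP; split; lra.
    rewrite /th.
    have -> : h (y0 + (t + s) *: v) - h y0 =
        (h (y0 + t *: v + s *: v) - h (y0 + t *: v) - s *: q) +
        ((h (y0 + t *: v) - h y0) + s *: q).
      by rewrite scalerDl addrA; apply/rowP => j; rewrite !mxE; ring.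
    have := le_row_normD normN (h (y0 + t *: v + s *: v) - h (y0 + t *: v) - s *: q)
        ((h (y0 + t *: v) - h y0) + s *: q).
    have := le_row_normD normN (h (y0 + t *: v) - h y0) (s *: q).
    rewrite row_normZ // gtr0_norm //.
    have : row_norm N (h (y0 + t *: v + s *: v) - h (y0 + t *: v) - s *: q) <= s * g.
      by near: s.
    nra.
  by move=> /filter_ex[s [? ?]]; exists (t + s).
have thC : continuous th.
  have lineC : continuous (fun t : R => h (y0 + t *: v) - h y0).
    move=> t; apply: continuousB; last exact: cvg_cst.
    apply: (@continuous_comp _ _ _ (fun t : R => y0 + t *: v)); last exact: h_cont.
    apply: continuousD; first exact: cvg_cst.
    by apply: continuousZr_tmp; exact: cvg_id.
  move=> t; apply: cvgB; last by apply: cvgMl; exact: cvg_id.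
  by apply: (@cvg_comp _ _ _ _ (row_norm N) _ _ _ (lineC t)); exact: row_norm_continuous.
have [t] := EVT_min (@ler01 R) (continuous_subspaceT thC).
rewrite in_itv /= => /andP[t0 t1] min_t.
have th01 : th 0 = th 1.
  have y0v : y0 + v = y1 by rewrite addrC subrK.
  by rewrite /th scale0r addr0 scale1r y0v hy0 hy1 -/v !subrr mul0r subr0 mul1r
    subrr /row_norm mulmx0 submul_norm0.
have [t_1|t_lt1] := eqVneq t 1; last first.
  have [|u /andP[tu u1] lt_u] := decr t; first by rewrite t0 lt_neqAle t_lt1.
  have := min_t u; rewrite in_itv /= u1 (le_trans t0 (ltW tu)) => /(_ erefl).
  by rewrite leNgt lt_u.
have [|u /andP[u0 u1] lt_u] := decr 0; first by rewrite lexx ltr01.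
have := min_t u; rewrite in_itv /= u1 (ltW u0) => /(_ erefl).
by rewrite leNgt t_1 -th01 lt_u.
Unshelve. all: by end_near. Qed.

End ContractionFixedPoint.


(** * First-order conditions for a self-map of a box *)

Lemma near_affine_gt0 (R : realType) (g k : R) :
  0 < g -> \forall t \near 0^'+, 0 < g + t * k.
Proof.
move=> g0; have k0 : 0 < `|k| + 1 by rewrite ltr_wpDl.
near=> t; have t0 : 0 < t by near: t; exact: nbhs_right_gt.
have : t < g / (`|k| + 1) by near: t; apply: nbhs_right_lt; exact: divr_gt0.
rewrite ltr_pdivlMr // => tg.
have : - `|k| <= k by rewrite lerNl -normrN ler_norm.
nra.
Unshelve. all: by end_near. Qed.

Lemma coord_residual (R : realType) n (u v w : 'rV[R]_n) e i :
  `|u - v - w| <= e -> v 0 i + w 0 i - e <= u 0 i <= v 0 i + w 0 i + e.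
Proof.
move=> /(le_trans (entry_le_norm _ 0 i)); rewrite !mxE ler_norml => /andP[? ?].
by apply/andP; split; lra.
Qed.

Section TangentDirections.
Variables (R : realType) (n : nat) (a b : 'rV[R]_n.+1) (h : 'rV[R]_n.+1 -> 'rV[R]_n.+1).
Hypothesis h_self : forall y, box a b y -> box a b (h y).
Variable y : 'rV[R]_n.+1.
Hypothesis h_diff : differentiable h y.

(** The value [h y] is maximal in coordinate [i] over the box, so it cannot
    increase along a direction that stays in the box. *)
Lemma tangent_image_le0 v i : (\forall t \near 0^'+, box a b (y + t *: v)) ->
  h y 0 i = b 0 i -> (v *m grad h y) 0 i <= 0.
Proof.
move=> vab hyi; rewrite leNgt; apply/negP => v0.
have e0 : 0 < (v *m grad h y) 0 i / 2 by rewrite divr_gt0.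
have [t [[t0 tab] te]] : exists t, (0 < t /\ box a b (y + t *: v)) /\
    `|h (y + t *: v) - h y - t *: (v *m grad h y)| <= (v *m grad h y) 0 i / 2 * t.
  apply: (@filter_ex _ 0^'+); near=> t; split; last first.
    by near: t; exact: expands_line (differentiable_expands h_diff) e0.
  by split; near: t; [exact: nbhs_right_gt|].
have [_ /(_ 0 i)] := h_self tab.
by have /andP[+ _] := coord_residual i te; rewrite [(_ *: (_ *m _)) _ _]mxE hyi; nra.
Unshelve. all: by end_near. Qed.

Lemma tangent_image_ge0 v i : (\forall t \near 0^'+, box a b (y + t *: v)) ->
  h y 0 i = a 0 i -> 0 <= (v *m grad h y) 0 i.
Proof.
move=> vab hyi; rewrite leNgt; apply/negP => v0.
have e0 : 0 < - (v *m grad h y) 0 i / 2 by rewrite divr_gt0 ?oppr_gt0.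
have [t [[t0 tab] te]] : exists t, (0 < t /\ box a b (y + t *: v)) /\
    `|h (y + t *: v) - h y - t *: (v *m grad h y)| <= - (v *m grad h y) 0 i / 2 * t.
  apply: (@filter_ex _ 0^'+); near=> t; split; last first.
    by near: t; exact: expands_line (differentiable_expands h_diff) e0.
  by split; near: t; [exact: nbhs_right_gt|].
have [/(_ 0 i) + _] := h_self tab.
by have /andP[_ +] := coord_residual i te; rewrite [(_ *: (_ *m _)) _ _]mxE hyi; nra.
Unshelve. all: by end_near. Qed.

Hypothesis y_ab : box a b y.

Lemma near_box (v : 'rV[R]_n.+1) :
  (forall i, y 0 i = a 0 i -> 0 <= v 0 i) -> (forall i, y 0 i = b 0 i -> v 0 i <= 0) ->
  \forall t \near 0^'+, box a b (y + t *: v).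
Proof.
move=> va vb; case: y_ab => ay yb.
have : \forall t \near 0^'+, forall i, a 0 i <= y 0 i + t * v 0 i <= b 0 i.
  apply: filter_forall => i; have t0 := nbhs_right_gt (0 : R).
  have near_lo : \forall t \near 0^'+, a 0 i <= y 0 i + t * v 0 i.
    have [yai|nyai] := eqVneq (y 0 i) (a 0 i).
      by apply: filterS t0 => t t0; rewrite yai lerDl mulr_ge0 ?va // ltW.
    have gap : 0 < y 0 i - a 0 i by rewrite subr_gt0 lt_neqAle eq_sym nyai ay.
    by apply: filterS (near_affine_gt0 (v 0 i) gap) => t; lra.
  have near_hi : \forall t \near 0^'+, y 0 i + t * v 0 i <= b 0 i.
    have [ybi|nybi] := eqVneq (y 0 i) (b 0 i).
      by apply: filterS t0 => t t0; rewrite ybi gerDl mulr_ge0_le0 ?vb // ltW.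
    have gap : 0 < b 0 i - y 0 i by rewrite subr_gt0 lt_neqAle nybi yb.
    by apply: filterS (near_affine_gt0 (- v 0 i) gap) => t; lra.
  by apply: filterS2 near_lo near_hi => t -> ->.
by apply: filterS => t tab; split=> j i; rewrite !mxE ord1; case/andP: (tab i).
Qed.

Lemma near_box_up l : y 0 l != b 0 l ->
  \forall t \near 0^'+, box a b (y + t *: delta_mx 0 l).
Proof.
move=> yl; apply: near_box => i; rewrite mxE eqxx /=; first by [].
by case: eqP => // -> yil; rewrite yil eqxx in yl.
Qed.

Lemma near_box_down l : y 0 l != a 0 l ->
  \forall t \near 0^'+, box a b (y + t *: (- delta_mx 0 l)).
Proof.
move=> yl; apply: near_box => i; rewrite !mxE eqxx /= ?oppr_le0 //.
by case: eqP => // [-> yil|_ _]; rewrite ?oppr0 //; rewrite yil eqxx in yl.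
Qed.

Lemma grad_le0_up l i : y 0 l != b 0 l -> h y 0 i = b 0 i -> grad h y l i <= 0.
Proof.
by move=> /near_box_up/tangent_image_le0 hle /hle; rewrite -rowE mxE.
Qed.

Lemma grad_ge0_up l i : y 0 l != b 0 l -> h y 0 i = a 0 i -> 0 <= grad h y l i.
Proof.
by move=> /near_box_up/tangent_image_ge0 hge /hge; rewrite -rowE mxE.
Qed.

Lemma grad_ge0_down l i : y 0 l != a 0 l -> h y 0 i = b 0 i -> 0 <= grad h y l i.
Proof.
move=> /near_box_down/tangent_image_le0 hle /hle.
by rewrite mulNmx -rowE !mxE oppr_le0.
Qed.

Lemma grad_le0_down l i : y 0 l != a 0 l -> h y 0 i = a 0 i -> grad h y l i <= 0.
Proof.
move=> /near_box_down/tangent_image_ge0 hge /hge.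
by rewrite mulNmx -rowE !mxE oppr_ge0.
Qed.

End TangentDirections.

(** * Slack constraints are not optimal *)

Lemma positive_combination (R : realType) n m (M : 'M[R]_(n, m)) (lam : 'cV[R]_m) i j :
  (forall j, 0 < lam j 0) -> (forall j, 0 <= M i j) -> 0 < M i j -> 0 < (M *m lam) i 0.
Proof.
move=> lam0 M0 Mij; rewrite mxE (bigD1 j) //= ltr_pwDl ?mulr_gt0 //.
by rewrite sumr_ge0 // => l _; rewrite mulr_ge0 // ltW.
Qed.

Section SubproblemImprovement.
Variables (R : realType) (n m : nat) (a b : 'rV[R]_n.+1).
Variables (h0 : 'rV[R]_n.+1 -> 'rV[R]_m.+1) (h : 'rV[R]_n.+1 -> 'rV[R]_n.+1).
Hypothesis h_self : forall y, box a b y -> box a b (h y).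
Hypothesis h0_diff : forall y, differentiable h0 y.
Hypothesis h_diff : forall y, differentiable h y.
Hypothesis sub_qualifies : general_qualifying_condition h0 h (box a b).

Lemma slack_constraint_improvement (lam : 'cV[R]_m.+1) y :
  (forall j, 0 < lam j 0) -> box a b y -> lemx y (h y) -> y <> h y ->
  exists2 y', box a b y' /\ lemx y' (h y') &
    (h0 y *m lam) 0 0 < (h0 y' *m lam) 0 0.
Proof.
move=> lam0 yab yh /eqP y_neq.
have [N [normN /(_ y yab) [[G0 Grow] NA1 [k [k0 Ak qk]]]]] := sub_qualifies.
have [S [Q [s [cert S0 SG0 SGpos]]]] := qualifying_certificate normN NA1 G0 Grow k0 Ak qk.
have [j slj] : exists j, y 0 j < h y 0 j.
  have /existsP[j yj] : [exists j, y 0 j != h y 0 j].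
    apply: contraNT y_neq; rewrite negb_exists => /forallP yhj.
    by apply/eqP/rowP => j; apply/eqP; have := yhj j; rewrite negbK.
  by exists j; rewrite lt_neqAle yj; exact: yh.
have [hay hyb] := h_self yab; have [ay yb] := yab.
pose lo i := y 0 i == a 0 i; pose up i := y 0 i == b 0 i.
have up_h i : up i -> h y 0 i = b 0 i.
  by move=> /eqP yi; apply/le_anti; rewrite hyb -yi yh.
have le0_up := grad_le0_up h_self (h_diff y) yab.
have ge0_up := grad_ge0_up h_self (h_diff y) yab.
have le0_down := grad_le0_down h_self (h_diff y) yab.
have ge0_down := grad_ge0_down h_self (h_diff y) yab.
have zeros : preserves_zeros (fun i => lo i && up i) (grad h y).
  move=> l i nDl /andP[/eqP loi upi].
  have hib := up_h _ upi; have hia : h y 0 i = a 0 i by rewrite hib -(eqP upi).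
  have [upl|nupl] := boolP (up l); apply/le_anti/andP; split.
  - by apply: (le0_down _ _ _ hia) => //; move: nDl; rewrite /= upl andbT.
  - by apply: (ge0_down _ _ _ hib) => //; move: nDl; rewrite /= upl andbT.
  - exact: (le0_up _ _ _ hib).
  - exact: (ge0_up _ _ _ hia).
have := @improving_direction _ _ _ _ _ _ lo up cert _ _ _ _ (grad h0 y *m lam)
  (fun i => y 0 i < h y 0 i) j.
move=> /(_ _ _ _ _ _ _ slj)[||||||d [dc0 dP]].
- by move=> l i loi upi nDl; apply: (S0 _ zeros) => //; rewrite loi.
- move=> l i upi _ nlol nupl; apply/le_anti; rewrite (le0_up _ _ _ (up_h _ upi)) //.
  by rewrite (ge0_down _ _ _ (up_h _ upi)).
- by move=> l i upi _ _ nupl; rewrite (le0_up _ _ _ (up_h _ upi)).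
- by move=> l i upi _ nlol _; rewrite (ge0_down _ _ _ (up_h _ upi)).
- move=> i; rewrite mulmxA -mulmxDl; have [j' j'0] := SGpos i.
  by apply: positive_combination j'0 => // j''; have := SG0 i j''; rewrite mxE.
- move=> i; apply: contraTN => /eqP yi; rewrite -leNgt yi; exact: hyb.
have tdE t i : (y + t *: d) 0 i = y 0 i + t * d 0 i by rewrite !mxE.
have d_box : \forall t \near 0^'+, box a b (y + t *: d).
  apply: near_box => // i yi; have [dlo dup _] := dP i.
    by apply: dlo; rewrite /lo yi.
  by apply: dup; rewrite /up yi.
have h_exp e : 0 < e -> \forall t \near 0^'+, forall i,
    h y 0 i + t * (d *m grad h y) 0 i - e * t <= h (y + t *: d) 0 i.
  move=> e0; have := expands_line d (differentiable_expands (h_diff y)) e0.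
  apply: filterS => t te i; have /andP[+ _] := coord_residual i te.
  by rewrite [(_ *: (_ *m _)) _ _]mxE.
have h0_exp e : 0 < e -> \forall t \near 0^'+,
    `|h0 (y + t *: d) - h0 y - t *: (d *m grad h0 y)| <= e * t.
  by move=> e0; exact: expands_line (differentiable_expands (h0_diff y)) e0.
have d_feas : \forall t \near 0^'+, forall i, (y + t *: d) 0 i <= h (y + t *: d) 0 i.
  apply: filter_forall => i; have [dlo dup [sli|di|[loi di]]] := dP i.
  - rewrite -subr_gt0 in sli.
    near=> t; have : 0 < (h y 0 i - y 0 i) + t * ((d *m grad h y) 0 i - d 0 i - 1).
      by near: t; exact: near_affine_gt0.
    have : h y 0 i + t * (d *m grad h y) 0 i - 1 * t <= h (y + t *: d) 0 i.
      by near: t; apply: filterS (h_exp _ ltr01) => t.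
    rewrite tdE; lra.
  - have e0 : 0 < (d *m grad h y) 0 i - d 0 i by rewrite subr_gt0.
    near=> t; have : h y 0 i + t * (d *m grad h y) 0 i - ((d *m grad h y) 0 i - d 0 i) * t
        <= h (y + t *: d) 0 i.
      by near: t; apply: filterS (h_exp _ e0) => t.
    have := yh 0 i; rewrite tdE; lra.
  - apply: filterS d_box => t tab; rewrite tdE di mulr0 addr0.
    by rewrite (eqP loi); have [+ _] := h_self tab; apply.
set dc := (d *m _) 0 0 in dc0.
have L0 : 0 < 2 * (entry_sum lam + 1) by rewrite mulr_gt0 // ltr_wpDl ?entry_sum_ge0.
pose e := dc / (2 * (entry_sum lam + 1)); have e0 : 0 < e by exact: divr_gt0.
have [t [t0 [tab tfeas texp]]] : exists t, 0 < t /\ [/\ box a b (y + t *: d),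
    forall i, (y + t *: d) 0 i <= h (y + t *: d) 0 i &
    `|h0 (y + t *: d) - h0 y - t *: (d *m grad h0 y)| <= e * t].
  apply: (@filter_ex _ 0^'+); near=> t; split; first by near: t; exact: nbhs_right_gt.
  by split; near: t => //; exact: h0_exp.
exists (y + t *: d); first by split=> // l i; rewrite ord1; exact: tfeas.
set r := h0 (y + t *: d) - h0 y - t *: (d *m grad h0 y) in texp.
have -> : (h0 (y + t *: d) *m lam) 0 0 = (h0 y *m lam) 0 0 + t * dc + (r *m lam) 0 0.
  have -> : h0 (y + t *: d) = h0 y + t *: (d *m grad h0 y) + r.
    by rewrite /r; apply/rowP => i; rewrite !mxE; ring.
  rewrite !mulmxDl -scalemxAl -mulmxA /dc; move: (d *m _) => D.
  by rewrite mxE [in LHS]mxE [X in _ + X + _]mxE.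
have : `|(r *m lam) 0 0| <= e * t * entry_sum lam.
  rewrite (le_trans (entry_le_norm _ _ _)) // (le_trans (norm_mulmx_le _ _)) //.
  by rewrite ler_wpM2r ?entry_sum_ge0.
rewrite ler_norml => /andP[rlam _].
have : e * t * entry_sum lam < t * dc.
  rewrite mulrAC mulrC ltr_pM2l // /e mulrAC ltr_pdivrMr //.
  rewrite ltr_pM2l //; have := entry_sum_ge0 lam; lra.
lra.
Unshelve. all: by end_near. Qed.

End SubproblemImprovement.


(** * The marginal gain of the parameter *)

(** The matrix [W = (1 - A)^-1 G] is the derivative of the objectives with
    respect to a shift of the fixed-point equation.  It satisfies
    [W = (1 + S) G + Q W], and [Q] is nonnegative with vanishing powers. *)
Lemma sensitivity_ge (R : realType) n m (A S Q : 'M[R]_n.+1) s (G : 'M[R]_(n.+1, m)) :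
  certificate A S Q s -> 1%:M - A \in unitmx -> lemx 0 (G + S *m G) ->
  lemx (G + S *m G) (invmx (1%:M - A) *m G).
Proof.
move=> [SA Q0 Qv _ _] uA SG0; set W := invmx _ *m G.
have WE : W = (G + S *m G) + Q *m W.
  apply/eqP; rewrite -subr_eq; apply/eqP.
  transitivity ((1%:M - Q) *m W); first by rewrite mulmxBl mul1mx.
  by rewrite -SA mulmxA mulmxK // mulmxDl mul1mx.
have W0 i j : 0 <= W i j.
  have : lemx 0 (col j W).
    apply: (vanishing_powers_subfix_col Q0 Qv) => l k; rewrite ord1 {k}.
    have -> : (Q *m col j W) l 0 = (Q *m W) l j.
      by rewrite !mxE; apply: eq_bigr => k _; rewrite mxE.
    have /matrixP/(_ l j) := WE; rewrite [RHS]mxE [col j W l 0]mxE => ->.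
    by rewrite lerDr; have := SG0 l j; rewrite mxE.
  by move=> /(_ i 0); rewrite !mxE.
move=> i j; have /matrixP/(_ i j) := WE; rewrite [RHS]mxE => ->.
rewrite lerDl mxE sumr_ge0 // => l _.
by rewrite mulr_ge0 //; have := Q0 i l; rewrite mxE.
Qed.

Section MarginalGain.
Variables (R : realType) (ny nz m : nat).
Variables (f0 : 'rV[R]_(ny.+1 + nz.+1) -> 'rV[R]_m.+1)
          (fy : 'rV[R]_(ny.+1 + nz.+1) -> 'rV[R]_ny.+1).

(** In the third case all entries are positive: column [j] of [W] is at most
    [Delta_y / (1 - |A|)] by [W = G + A W] read at its largest entry. *)
Lemma marginal_gain_gt0 (x : 'rV[R]_(ny.+1 + nz.+1)) (W : 'M[R]_(ny.+1, m.+1))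
    (lam : 'cV[R]_m.+1) i :
  (forall j, 0 < lam j 0) -> lemx 0 (grad_y f0 x) ->
  W = grad_y f0 x + grad_y fy x *m W ->
  lemx 0 W -> (forall l, exists j, 0 < W l j) ->
  [\/ cond_i f0 fy x, cond_ii f0 fy x | cond_iii f0 fy x] ->
  0 < ((grad_z f0 x + grad_z fy x *m W) *m lam) i 0.
Proof.
move=> lam0 G0 WE W0' Wrow.
have W0 l j : 0 <= W l j by have := W0' l j; rewrite mxE.
case=> [[C0 [B0 Brow]]|[[C0 Crow] B0]|[A1 BA]].
- have CB0 j : 0 <= (grad_z f0 x + grad_z fy x *m W) i j.
    rewrite mxE addr_ge0 //; first by have := C0 i j; rewrite mxE.
    rewrite mxE sumr_ge0 // => l _; rewrite mulr_ge0 //.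
    by have := B0 i l; rewrite mxE.
  have [l Bil] := nonneg_row_pos_entry i B0 Brow; have [j Wlj] := Wrow l.
  apply: (positive_combination lam0 CB0 (j := j)).
  rewrite mxE ltr_wpDl //; first by have := C0 i j; rewrite mxE.
  rewrite mxE (bigD1 l) //= ltr_pwDl ?mulr_gt0 // sumr_ge0 // => k _.
  by rewrite mulr_ge0 //; have := B0 i k; rewrite mxE.
- have BW0 j : 0 <= (grad_z fy x *m W) i j.
    rewrite mxE sumr_ge0 // => l _; rewrite mulr_ge0 //.
    by have := B0 i l; rewrite mxE.
  have [j Cij] := nonneg_row_pos_entry i C0 Crow.
  apply: (positive_combination lam0 (j := j)); last by rewrite mxE ltr_pwDl.
  by move=> j'; rewrite mxE addr_ge0 //; have := C0 i j'; rewrite mxE.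
suff pos j : 0 < (grad_z f0 x + grad_z fy x *m W) i j.
  by apply: (positive_combination lam0 (j := 0)) => // j; rewrite ltW.
have GD l : grad_y f0 x l j <= Delta_y f0 x.
  rewrite (le_trans _ (le_ord_max _ l)) //.
  exact: (le_ord_max (fun j => grad_y f0 x l j)).
have dC : delta_z f0 x <= grad_z f0 x i j.
  by rewrite (le_trans (ord_min_le _ i)) // ord_min_le.
have [l0 W_l0] : exists l0, forall l, W l j <= W l0 j.
  have [l0 _ maxl0] := @arg_maxP _ _ _ ord0 predT (fun l => W l j) isT.
  by exists l0 => l; exact: maxl0.
have AW := @mulmx_entry_bound _ _ _ _ (grad_y fy x) W l0 j (W l0 j) (W0 _ _).
have BW := @mulmx_entry_bound _ _ _ _ (grad_z fy x) W i j (W l0 j) (W0 _ _).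
have Wabs l : `|W l j| <= W l0 j by rewrite ger0_norm.
have {AW} := AW Wabs; have {BW} := BW Wabs.
rewrite !ler_norml => /andP[BW _] /andP[_ AW].
have W_le : W l0 j <= Delta_y f0 x + norm_infty (grad_y fy x) * W l0 j.
  by rewrite {1}WE mxE lerD.
have D0 : 0 <= Delta_y f0 x.
  by rewrite (le_trans _ (GD 0)) //; have := G0 0 j; rewrite mxE.
have A1' : 0 < 1 - norm_infty (grad_y fy x) by rewrite subr_gt0.
have B0 := norm_infty_ge0 (grad_z fy x).
have {D0} D0 : 0 < Delta_y f0 x.
  rewrite lt_neqAle D0 andbT; apply: contraTneq BA => <-.
  by rewrite invr0 mulr0 -leNgt divr_ge0 // ltW.
rewrite ltr_pdivlMr // mulrAC ltr_pdivrMr // in BA.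
rewrite mxE.
have : norm_infty (grad_z fy x) * W l0 j < delta_z f0 x; last by lra.
rewrite -(ltr_pM2r A1') (le_lt_trans _ BA) // -mulrA ler_wpM2l //; lra.
Qed.

End MarginalGain.


(** * Improvement along the fixed points *)

Lemma prod_box_row_mx (R : realType) m n (a b : 'rV[R]_m) (c d : 'rV[R]_n) :
  prod_box (box a b) (box c d) = box (row_mx a c) (row_mx b d).
Proof.
have lemx_row p (u u' : 'M[R]_(1, p)) : lemx u u' <-> forall j, u 0 j <= u' 0 j.
  by split=> [uu' j|uu' i j]; rewrite ?ord1.
apply/seteqP; split=> x /=.
  move=> [[ax xb] [cx xd]]; split; apply/lemx_row => j;
    case: (split_ordP j) => k ->; rewrite ?row_mxEl ?row_mxEr.
  - by have := ax 0 k; rewrite mxE.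
  - by have := cx 0 k; rewrite mxE.
  - by have := xb 0 k; rewrite mxE.
  - by have := xd 0 k; rewrite mxE.
move=> [lex xle]; split; split; apply/lemx_row => j; rewrite mxE.
- by have := lex 0 (lshift n j); rewrite row_mxEl.
- by have := xle 0 (lshift n j); rewrite row_mxEl.
- by have := lex 0 (rshift m j); rewrite row_mxEr.
- by have := xle 0 (rshift m j); rewrite row_mxEr.
Qed.

Lemma norm_row_mx_le (R : realType) m n (u : 'rV[R]_m) (v : 'rV[R]_n) :
  `|row_mx u v| <= `|u| + `|v|.
Proof.
apply: norm_le_entries => [|i j]; first by rewrite addr_ge0.
rewrite mxE; case: (fintype.split j) => k.
  by rewrite (le_trans (entry_le_norm _ _ _)) // lerDl.
by rewrite (le_trans (entry_le_norm _ _ _)) // lerDr.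
Qed.

Lemma compact_sublevel (R : realType) n (K : set 'rV[R]_n) (F : 'rV[R]_n -> R) r :
  compact K -> continuous F -> compact (K `&` [set v | F v <= r]).
Proof.
move=> cK cF; apply: (subclosed_compact _ cK); last by move=> v [].
apply: closedI; last exact: closed_sublevel.
exact: (compact_closed (@norm_hausdorff _ _) cK).
Qed.

Lemma norm_sub_continuous (R : realType) (T : topologicalType) (V : normedModType R)
    (f g : T -> V) :
  continuous f -> continuous g -> continuous (fun x => `|f x - g x|).
Proof. by move=> cf cg x; apply: cvg_norm; apply: cvgB; [exact: cf | exact: cg]. Qed.

Section Problem.
Variables (R : realType) (ny nz m : nat).
Variables (f0 : 'rV[R]_(ny.+1 + nz.+1) -> 'rV[R]_m.+1)
          (fy : 'rV[R]_(ny.+1 + nz.+1) -> 'rV[R]_ny.+1)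
          (ay by_ : 'rV[R]_ny.+1) (az bz : 'rV[R]_nz.+1).
Hypothesis f0_diff : forall x, differentiable f0 x.
Hypothesis fy_diff : forall x, differentiable fy x.
Hypothesis le_ab_y : lemx ay by_.
Hypothesis le_ab_z : lemx az bz.
Let Xy := box ay by_.
Let Xz := box az bz.
Hypothesis fy_self : forall y z, Xy y -> Xz z -> Xy (fy (row_mx y z)).
Hypothesis sub_qualifies : forall z, Xz z ->
  general_qualifying_condition
    (fun y => f0 (row_mx y z)) (fun y => fy (row_mx y z)) Xy.
Hypothesis z_cond : forall y z, Xy y -> Xz z ->
  [\/ cond_i f0 fy (row_mx y z), cond_ii f0 fy (row_mx y z) |
      cond_iii f0 fy (row_mx y z)].

Let sub_diff p (F : 'rV[R]_(ny.+1 + nz.+1) -> 'rV[R]_p) z :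
  (forall x, differentiable F x) -> forall y, differentiable (fun y => F (row_mx y z)) y.
Proof. by move=> dF y; exact: differentiable_row_mxl. Qed.

Lemma sub_fixed_point z : Xz z -> exists2 y, Xy y & fy (row_mx y z) = y.
Proof.
move=> zX; have [N [normN qN]] := sub_qualifies zX.
apply: (contraction_fixed_point normN (sub_diff z fy_diff)) => //.
  by move=> y /qN[].
by move=> y yX; exact: fy_self.
Qed.

Lemma sub_fixed_point_unique z y0 y1 : Xz z -> Xy y0 -> Xy y1 ->
  fy (row_mx y0 z) = y0 -> fy (row_mx y1 z) = y1 -> y0 = y1.
Proof.
move=> zX; have [N [normN qN]] := sub_qualifies zX.
apply: (contraction_fixed_point_unique normN (sub_diff z fy_diff)) => //.
by move=> y /qN[].
Qed.

(** On the compact set of the solutions [(y', z')] with [y'] at distance at least [eta]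
    from [y], the distance from [z'] to [z] attains its minimum, which is
    positive because the fixed point at [z] is unique. *)
Lemma fixed_point_continuity y z eta : Xy y -> Xz z -> fy (row_mx y z) = y -> 0 < eta ->
  exists2 del, 0 < del & forall y' z', Xy y' -> Xz z' -> `|z' - z| < del ->
    fy (row_mx y' z') = y' -> `|y' - y| < eta.
Proof.
move=> yX zX fixy eta0; apply: contrapT => ndel.
pose res (x : 'rV[R]_(ny.+1 + nz.+1)) := `|fy x - lsubmx x|.
pose far (x : 'rV[R]_(ny.+1 + nz.+1)) := - `|lsubmx x - y|.
pose dist (x : 'rV[R]_(ny.+1 + nz.+1)) := `|rsubmx x - z|.
have lC : continuous (lsubmx : 'rV[R]_(ny.+1 + nz.+1) -> 'rV[R]_ny.+1).
  exact: continuous_lsubmx.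
have rC : continuous (rsubmx : 'rV[R]_(ny.+1 + nz.+1) -> 'rV[R]_nz.+1).
  exact: continuous_rsubmx.
have resC : continuous res.
  by apply: norm_sub_continuous lC => x; exact: differentiable_continuous.
have cstC p (u : 'rV[R]_p) : continuous (fun _ : 'rV[R]_(ny.+1 + nz.+1) => u).
  exact: cst_continuous.
have farC : continuous far.
  by move=> x; apply: (continuousN (norm_sub_continuous lC (cstC _ y) (x := x))).
have distC : continuous dist := norm_sub_continuous rC (cstC _ z).
pose K := (box (row_mx ay az) (row_mx by_ bz) `&` [set x | res x <= 0])
  `&` [set x | far x <= - eta].
have cK : compact K by do !apply: compact_sublevel => //; exact: box_compact.
have K_of y' z' : Xy y' -> Xz z' -> fy (row_mx y' z') = y' -> eta <= `|y' - y| ->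
    K (row_mx y' z').
  move=> y'X z'X fixy' fary'; split; first split.
  - by rewrite -prod_box_row_mx; split; rewrite ?row_mxKl ?row_mxKr.
  - by rewrite /= /res row_mxKl fixy' subrr normr0.
  - by rewrite /= /far row_mxKl lerN2.
have K0 : K !=set0.
  apply: contrapT => /forallNP K0; apply: ndel; exists 1 => // y' z' y'X z'X _ fixy'.
  by rewrite ltNge; apply/negP => /(K_of _ _ y'X z'X fixy'); exact: K0.
have [x [[xX /= resx] /= farx] minx] := compact_argmin K0 cK distC.
move: xX; rewrite -prod_box_row_mx => -[xXy xXz].
have fixx : fy (row_mx (lsubmx x) (rsubmx x)) = lsubmx x.
  rewrite hsubmxK; apply/eqP; rewrite -subr_eq0 -normr_le0; exact: resx.
have dist0 : 0 < dist x.
  rewrite lt_neqAle normr_ge0 andbT eq_sym normr_eq0 subr_eq0; apply/eqP => xz.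
  rewrite xz in fixx; have := sub_fixed_point_unique zX xXy yX fixx fixy => xy.
  by move: farx; rewrite /far xy subrr normr0 lerN2 leNgt eta0.
apply: ndel; exists (dist x) => // y' z' y'X z'X z'z fixy'.
rewrite ltNge; apply/negP => /(K_of _ _ y'X z'X fixy') /minx.
by rewrite /dist row_mxKr leNgt z'z.
Qed.

(** The new point is feasible because it is again a fixed point, which spares any
    discussion of the bounds on [y]. *)
Lemma parameter_improvement (lam : 'cV[R]_m.+1) y z i :
  (forall j, 0 < lam j 0) -> Xy y -> Xz z -> fy (row_mx y z) = y -> z 0 i < bz 0 i ->
  exists y' z', [/\ Xy y', Xz z', fy (row_mx y' z') = y' &
    (f0 (row_mx y z) *m lam) 0 0 < (f0 (row_mx y' z') *m lam) 0 0].
Proof.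
move=> lam0 yX zX fixy zi; set x := row_mx y z.
have [N [normN /(_ y yX)]] := sub_qualifies zX.
rewrite !grad_row_mxl // -/x => -[[G0 Grow] NA1 [k [k0 Ak qk]]].
have [S [Q [s [cert _ SG0 SGpos]]]] := qualifying_certificate normN NA1 G0 Grow k0 Ak qk.
set A := grad_y fy x in NA1 Ak qk cert; set G := grad_y f0 x in G0 Grow qk SG0 SGpos.
have uA : 1%:M - A \in unitmx := vanishing_powers_unit (submul_norm_vanishing normN NA1).
pose L := invmx (1%:M - A); pose W := L *m G.
have W_ge := sensitivity_ge cert uA SG0.
have WE : W = G + A *m W.
  apply/eqP; rewrite -subr_eq -[X in X - _]mul1mx -mulmxBl /W mulmxA mulmxV // mul1mx.
  exact: eqxx.
have W0 : lemx 0 W by move=> l j; exact: le_trans (SG0 l j) (W_ge l j).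
have Wpos l : exists j, 0 < W l j.
  by have [j lj] := SGpos l; exists j; exact: lt_le_trans lj (W_ge l j).
pose B := grad_z fy x; pose C := grad_z f0 x.
have kap0 : 0 < ((C + B *m W) *m lam) i 0.
  by apply: marginal_gain_gt0 => //; exact: z_cond.
set kap := (_ *m lam) i 0 in kap0.
pose ei : 'rV[R]_nz.+1 := delta_mx 0 i.
pose La := entry_sum L; pose be := `|ei *m B|.
pose M := 2 * La * be + 2; pose T := entry_sum (W *m lam) + entry_sum lam.
have La0 : 0 <= La := entry_sum_ge0 _.
have be0 : 0 <= be by exact: normr_ge0.
have T0 : 0 <= T by rewrite addr_ge0 ?entry_sum_ge0.
have M0 : 0 < M by rewrite ltr_wpDl ?mulr_ge0.
have den0 : 0 < 2 * La * kap + 2 * M * T + 1.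
  by rewrite ltr_wpDl // addr_ge0 // !mulr_ge0 // ltW.
(* This tolerance gives [e * La <= 1 / 2], by which the displacement is at most
   [t * M], and [e * M * T <= kap / 2], by which at least half of the first-order
   gain [t * kap] survives. *)
pose e := kap / (2 * La * kap + 2 * M * T + 1).
have e0 : 0 < e by exact: divr_gt0.
have MT0 : 0 <= M * T by rewrite mulr_ge0 // ltW.
have Lk0 : 0 <= La * kap by rewrite mulr_ge0 // ltW.
have eLa : e * La <= 1 / 2 by rewrite mulrAC ler_pdivrMr //; nra.
have eMT : e * (M * T) <= kap / 2 by rewrite mulrAC ler_pdivrMr //; nra.
have [d d0 x_exp] : exists2 d, 0 < d & forall v, `|v| < d ->
    `|fy (x + v) - fy x - v *m grad fy x| <= e * `|v| /\
    `|f0 (x + v) - f0 x - v *m grad f0 x| <= e * `|v|.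
  have /nbhs_ballP[d1 /= d10 hd1] := differentiable_expands (fy_diff x) e0.
  have /nbhs_ballP[d2 /= d20 hd2] := differentiable_expands (f0_diff x) e0.
  exists (Num.min d1 d2); first by rewrite lt_min d10.
  move=> v; rewrite lt_min => /andP[v1 v2]; split.
    by apply: hd1; rewrite -ball_normE /= sub0r normrN.
  by apply: hd2; rewrite -ball_normE /= sub0r normrN.
have [|del del0 del_near] := fixed_point_continuity yX zX fixy (eta := d / 2).
  by rewrite divr_gt0.
have [t [t0 t_del t_d t_z]] : exists t,
    [/\ 0 < t, t < del, t < d / 2 & t <= bz 0 i - z 0 i].
  exists (Num.min (Num.min (del / 2) (d / 4)) (bz 0 i - z 0 i)).
  rewrite !lt_min !gt_min ge_min lexx orbT subr_gt0 zi !divr_gt0 //=.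
  split=> //; first by apply/orP; left; apply/orP; left; lra.
  by apply/orP; left; apply/orP; right; lra.
pose z' := z + t *: ei.
have z'X : Xz z'.
  have [az' bz'] := zX; split=> l j; rewrite ord1 !mxE eqxx /=.
    have := az' 0 j; have : 0 <= t * (j == i)%:R by rewrite mulr_ge0 // ltW.
    lra.
  by case: eqP => [->|_]; [rewrite mulr1; lra | rewrite mulr0 addr0; exact: bz'].
have [y' y'X fixy'] := sub_fixed_point z'X.
have nei : `|t *: ei| <= t.
  rewrite normrZ gtr0_norm // ger_pMr //; apply: norm_le_entries => // l j.
  by rewrite mxE; case: andP => _; rewrite ?normr1 ?normr0.
have near_y : `|y' - y| < d / 2.
  by apply: (del_near y' z') => //; rewrite /z' addrC addKr (le_lt_trans nei).
exists y', z'; split=> //.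
pose v := row_mx (y' - y) (t *: ei).
have xv : row_mx y' z' = x + v.
  by rewrite /v /x add_row_mx [y + _]addrC subrK.
have nv : `|v| <= `|y' - y| + t.
  by rewrite (le_trans (norm_row_mx_le _ _)) // lerD2l.
have [|fy_v f0_v] := x_exp v; first by rewrite (le_lt_trans nv) //; lra.
have vmul p (F : 'rV[R]_(ny.+1 + nz.+1) -> 'rV[R]_p) :
    v *m grad F x = (y' - y) *m grad_y F x + t *: (ei *m grad_z F x).
  by rewrite -[grad F x]vsubmxK mul_row_col -scalemxAl.
rewrite !vmul -xv fixy' fixy -/A -/B -/C -/G in fy_v f0_v.
set r := _ - _ in fy_v; set r0 := _ - _ in f0_v.
have dy : y' - y = (t *: (ei *m B) + r) *m L.
  have -> : t *: (ei *m B) + r = (y' - y) *m (1%:M - A).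
    rewrite /r mulmxBr mulmx1; move: (_ *m A) (t *: _) => u w.
    by apply/rowP => l; rewrite !mxE; ring.
  by rewrite mulmxK.
set P := `|y' - y| in nv near_y.
have P0 : 0 <= P by exact: normr_ge0.
have r_le : `|r| <= e * (P + t) by rewrite (le_trans fy_v) // ler_pM2l.
have r0_le : `|r0| <= e * (P + t) by rewrite (le_trans f0_v) // ler_pM2l.
have P_le : P <= (t * be + e * (P + t)) * La.
  rewrite {1}/P dy (le_trans (norm_mulmx_le _ _)) // ler_wpM2r //.
  by rewrite (le_trans (ler_normD _ _)) // lerD // normrZ gtr0_norm.
have Pt_le : P + t <= t * M.
  have : e * La * (P + t) <= 1 / 2 * (P + t) by rewrite ler_wpM2r // addr_ge0 // ltW.
  by rewrite /M; lra.
have f0E : (f0 (row_mx y' z') *m lam) 0 0 =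
    (f0 x *m lam) 0 0 + t * kap + (r *m (W *m lam)) 0 0 + (r0 *m lam) 0 0.
  have -> : f0 (row_mx y' z') = f0 x + t *: (ei *m (C + B *m W)) + r *m W + r0.
    have -> : f0 (row_mx y' z') =
        f0 x + ((y' - y) *m G + t *: (ei *m C)) + r0.
      by rewrite /r0; apply/rowP => l; rewrite !mxE; ring.
    rewrite dy -mulmxA -/W mulmxDl -scalemxAl mulmxDr scalerDr mulmxA.
    by apply/rowP => l; rewrite !mxE; ring.
  have -> : kap = (ei *m ((C + B *m W) *m lam)) 0 0 by rewrite -rowE mxE.
  move: (C + B *m W) => CB; clearbody r r0 W; rewrite !mulmxDl -scalemxAl -!mulmxA.
  move: (f0 x *m lam) (ei *m _) (r *m (W *m lam)) (r0 *m lam) => u1 u2 u3 u4.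
  by rewrite !mxE.
have rW : `|(r *m (W *m lam)) 0 0| <= e * (t * M) * entry_sum (W *m lam).
  rewrite (le_trans (entry_le_norm _ _ _)) // (le_trans (norm_mulmx_le _ _)) //.
  by rewrite ler_wpM2r ?entry_sum_ge0 // (le_trans r_le) // ler_pM2l.
have r0l : `|(r0 *m lam) 0 0| <= e * (t * M) * entry_sum lam.
  rewrite (le_trans (entry_le_norm _ _ _)) // (le_trans (norm_mulmx_le _ _)) //.
  by rewrite ler_wpM2r ?entry_sum_ge0 // (le_trans r0_le) // ler_pM2l.
rewrite f0E; move: rW r0l; rewrite !ler_norml => /andP[rW _] /andP[r0l _].
have : e * (M * T) * t <= kap / 2 * t by rewrite ler_pM2r.
have : 0 < t * kap by rewrite mulr_gt0.
by rewrite /T; lra.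
Qed.

(** * The unique optimum *)

Let X := prod_box Xy Xz.
Let Fe := feasible_Q fy X.

Lemma maximizer_fixed (lam : 'cV[R]_m.+1) x :
  (forall j, 0 < lam j 0) -> Fe x ->
  (forall x', Fe x' -> (f0 x' *m lam) 0 0 <= (f0 x *m lam) 0 0) ->
  fy x = lsubmx x /\ rsubmx x = bz.
Proof.
move=> lam0; rewrite -{1 2 3}(hsubmxK x); move: (lsubmx x) (rsubmx x) => y z.
rewrite /Fe /feasible_Q /X /prod_box /= row_mxKl row_mxKr => -[yfy [yX zX]] maxx.
have fixy : fy (row_mx y z) = y.
  apply: contrapT => /nesym y_neq.
  have h_self y' : Xy y' -> Xy (fy (row_mx y' z)) by move=> y'X; exact: fy_self.
  have [y' [y'X y'fy]] := slack_constraint_improvement h_self (sub_diff z f0_diff)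
    (sub_diff z fy_diff) (sub_qualifies zX) lam0 yX yfy y_neq.
  apply/negP; rewrite -leNgt; apply: maxx.
  by rewrite row_mxKl row_mxKr.
split=> //; apply/rowP => i; apply/le_anti; rewrite (zX.2 0 i) /= leNgt; apply/negP => zi.
have [y' [z' [y'X z'X fixy']]] := parameter_improvement lam0 yX zX fixy zi.
apply/negP; rewrite -leNgt; apply: maxx.
by rewrite row_mxKl row_mxKr fixy'; split=> // i' j'.
Qed.

Lemma feasible_compact : compact Fe.
Proof.
have cX : compact X by rewrite /X prod_box_row_mx; exact: box_compact.
have -> : Fe = X `&`
    \bigcap_(i in [set: 'I_ny.+1]) [set x | lsubmx x 0 i - fy x 0 i <= 0].
  apply/seteqP; split=> x [] h1 h2.
    by split=> // i _ /=; rewrite subr_le0.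
  by split=> // l i; rewrite ord1 -subr_le0; exact: h2.
apply: (subclosed_compact _ cX); last by move=> x [].
apply: closedI; first exact: (compact_closed (@norm_hausdorff _ _) cX).
apply: closed_bigI => i _; apply: closed_sublevel => x.
have entryC : continuous (fun u : 'rV[R]_ny.+1 => u 0 i) by exact: coord_continuous.
apply: continuousB.
  apply: (@cvg_comp _ _ _ _ (fun u : 'rV_ny.+1 => u 0 i) _ _ _ (continuous_lsubmx (x := x))).
  exact: entryC.
apply: (@cvg_comp _ _ _ _ (fun u : 'rV_ny.+1 => u 0 i) _ _ _
  (differentiable_continuous (fy_diff x))).
exact: entryC.
Qed.

Lemma scalarized_optimum : exists xs, [/\ Fe xs, xs = with_const_z fy bz xs,
  forall x, X x -> x = with_const_z fy bz x -> x = xs &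
  forall (lam : 'cV[R]_m.+1) x, (forall j, 0 < lam j 0) -> Fe x -> x <> xs ->
    (f0 x *m lam) 0 0 < (f0 xs *m lam) 0 0].
Proof.
have bzX : Xz bz by split=> // i j.
have [ys ysX fixys] := sub_fixed_point bzX.
pose xs := row_mx ys bz.
have Fxs : Fe xs.
  by rewrite /Fe /feasible_Q /X /prod_box /= row_mxKl row_mxKr fixys; split=> // i j.
have fixed_eq u : Xy (lsubmx u) -> fy u = lsubmx u -> rsubmx u = bz -> u = xs.
  move=> uX fixu zu; rewrite -(hsubmxK u) zu /xs; congr row_mx.
  by apply: (sub_fixed_point_unique bzX) => //; rewrite -zu hsubmxK.
exists xs; split=> //; first by rewrite /with_const_z fixys.
  move=> u [uX _] uf; apply: fixed_eq => //.
    by rewrite [in RHS]uf /with_const_z row_mxKl.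
  by rewrite {1}uf /with_const_z row_mxKr.
move=> lam x lam0 Fx x_neq.
have PhiC : continuous (fun x => - (f0 x *m lam) 0 0).
  have mulC : continuous (fun u : 'rV[R]_m.+1 => (u *m lam) 0 0).
    apply: (@lipschitz_continuous _ _ _ (entry_sum lam + 1)) => [|u v].
      by rewrite ltr_wpDl ?entry_sum_ge0.
    have -> : (u *m lam) 0 0 - (v *m lam) 0 0 = ((u - v) *m lam) 0 0.
      by rewrite mulmxBl !mxE.
    rewrite (le_trans (entry_le_norm _ _ _)) // (le_trans (norm_mulmx_le _ _)) //.
    by rewrite mulrC ler_wpM2r // lerDl.
  move=> u; apply: continuousN.
  apply: (@cvg_comp _ _ _ _ (fun u : 'rV_m.+1 => (u *m lam) 0 0) _ _ _
    (differentiable_continuous (f0_diff u))).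
  exact: mulC.
have [xm Fxm minxm] := compact_argmin (ex_intro _ xs Fxs) feasible_compact PhiC.
have max_eq u : Fe u -> (forall x', Fe x' -> (f0 x' *m lam) 0 0 <= (f0 u *m lam) 0 0) ->
    u = xs.
  move=> Fu maxu; have [fixu zu] := maximizer_fixed lam0 Fu maxu.
  by case: (Fu) => _ [uX _]; exact: fixed_eq.
have xmE : xm = xs by apply: max_eq => // x' /minxm; rewrite lerN2.
have max_xs x' : Fe x' -> (f0 x' *m lam) 0 0 <= (f0 xs *m lam) 0 0.
  by rewrite -xmE => /minxm; rewrite lerN2.
rewrite lt_neqAle max_xs // andbT; apply/eqP => eqx; apply: x_neq.
by apply: max_eq => // x'; rewrite eqx; exact: max_xs.
Qed.

End Problem.

(** Giving weight [1 + b / a] to a coordinate where [u] exceeds [v] by [a] makes its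
    contribution outweigh the others, whose total is at least [- b]. *)
Lemma le_of_positive_weights (R : realType) m (u v : 'rV[R]_m) :
  (forall lam : 'cV_m, (forall j, 0 < lam j 0) -> (u *m lam) 0 0 < (v *m lam) 0 0) ->
  lemx u v.
Proof.
move=> uv i j; rewrite ord1 {i} leNgt; apply/negP => lt_vu.
pose a := u 0 j - v 0 j; have a0 : 0 < a by rewrite subr_gt0.
pose b := l1 (u - v); have b0 : 0 <= b := l1_ge0 _.
pose lam : 'cV[R]_m := \col_l if l == j then 1 + b / a else 1.
have : (u *m lam) 0 0 < (v *m lam) 0 0.
  apply: uv => l; rewrite mxE; case: eqP => // _.
  by rewrite ltr_pwDl // divr_ge0 // ltW.
apply/negP; rewrite -leNgt -subr_ge0.
have -> : (u *m lam) 0 0 - (v *m lam) 0 0 = \sum_l (u - v) 0 l + b.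
  rewrite !mxE -sumrB (bigD1 j) //= [in RHS](bigD1 j) //= !mxE eqxx.
  rewrite (eq_bigr (fun l => (u - v) 0 l)) => [|l /negbTE lj].
    rewrite -mulrBl -/a mulrDr mulr1 mulrCA divff ?gt_eqF // mulr1.
    by rewrite addrAC.
  by rewrite !mxE lj !mulr1.
have : - b <= \sum_l (u - v) 0 l; last by lra.
by rewrite lerNl -sumrN ler_sum // => l _; rewrite -normrN ler_norm.
Qed.

Theorem proposition20 (R : realType) (ny nz m : nat)
    (f0 : 'rV[R]_(ny.+1 + nz.+1) -> 'rV[R]_m.+1)
    (fy : 'rV[R]_(ny.+1 + nz.+1) -> 'rV[R]_ny.+1)
    (ay by_ : 'rV[R]_ny.+1) (az bz : 'rV[R]_nz.+1)
    (Xy := box ay by_) (Xz := box az bz) (X := prod_box Xy Xz)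
    (f := with_const_z fy bz)
    (f0_diff : forall x, differentiable f0 x)
    (fy_diff : forall x, differentiable fy x)
    (le_ab_y : lemx ay by_) (le_ab_z : lemx az bz)
    (f_self : forall x, X x -> X (f x)) :
  feasible_Q fy X = feasible_full f X /\
  ((forall z, Xz z ->
      general_qualifying_condition
        (fun y => f0 (row_mx y z)) (fun y => fy (row_mx y z)) Xy) ->
   (forall x, X x -> [\/ cond_i f0 fy x, cond_ii f0 fy x | cond_iii f0 fy x]) ->
   fast_lipschitz f0 (feasible_Q fy X) X f).
Proof.
have X_row y z : Xy y -> Xz z -> X (row_mx y z).
  by move=> yX zX; rewrite /X /prod_box /= row_mxKl row_mxKr.
split.
  apply/seteqP; split=> x [le_x xX]; split=> // i j.
    rewrite ord1 /f /with_const_z -[in leLHS](hsubmxK x).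
    case: (split_ordP j) => l ->; rewrite ?row_mxEl ?row_mxEr; first exact: le_x.
    by case: xX => _ [_]; exact.
  have := le_x i (lshift nz.+1 j).
  by rewrite /f /with_const_z row_mxEl mxE.
move=> sub_qualifies cond.
have fy_self y z : Xy y -> Xz z -> Xy (fy (row_mx y z)).
  by move=> yX zX; have [+ _] := f_self _ (X_row _ _ yX zX); rewrite row_mxKl.
have z_cond y z (yX : Xy y) (zX : Xz z) := cond _ (X_row _ _ yX zX).
have [xs [Fxs fixxs fixed_eq optxs]] :=
  scalarized_optimum f0_diff fy_diff le_ab_y le_ab_z fy_self sub_qualifies z_cond.
have f0_le x : feasible_Q fy X x -> x <> xs -> lemx (f0 x) (f0 xs).
  by move=> Fx x_neq; apply: le_of_positive_weights => lam lam0; exact: optxs.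
pose one : 'cV[R]_m.+1 := const_mx 1.
have one0 j : 0 < one j 0 by rewrite mxE.
exists xs; split; apply/seteqP; split=> x /=.
- move=> [Fx nx]; apply: contrapT => x_neq; apply: nx.
  by exists xs; split=> //; [exact: nesym | exact: f0_le].
- move=> ->; split=> // -[x' [Fx' x'_neq le_x']].
  have := optxs one x' one0 Fx' x'_neq; apply/negP; rewrite -leNgt !mxE.
  by apply: ler_sum => j _; rewrite mxE !mulr1.
- by move=> [xX fixx]; exact: fixed_eq.
- by move=> ->; split=> //; case: Fxs.
Qed.
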